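(* Let $G$ and $H$ be connected Lie groups. Let $\mathcal{X}_0=\mathcal{X},\mathcal{X}_1,\ldots,\mathcal{X}_m$ be pairwise commuting linear vector fields on $G$ with flows $\varphi^i_t$, and $\mathcal{Y}_0=\mathcal{Y},\mathcal{Y}_1,\ldots,\mathcal{Y}_m$ pairwise commuting linear vector fields on $H$ with flows $\psi^i_t$. Let $Z_0=Z,Z_1,\ldots,Z_m$ be right invariant vector fields on $G$ and $W_0=W,W_1,\ldots,W_m$ right invariant vector fields on $H$. Consider the affine systems $$\frac{dg}{dt}=(\mathcal{X}+Z)(g)+\sum_{j=1}^{m}u_j(\mathcal{X}_j+Z_j)(g),\qquad \frac{dh}{dt}=(\mathcal{Y}+W)(h)+\sum_{j=1}^{m}u_j(\mathcal{Y}_j+W_j)(h)$$ on $G$ and $H$, with the same class of admissible controls, and denote by $\phi_t(g,u)$ and $\theta_t(h,u)$ their respective solutions starting at $g\in G$ and $h\in H$. Let $F:G\to H$ be a homomorphism of Lie groups. Then the following conditions are equivalent: 1. $F(\phi_t(g,u))=\theta_t(F(g),u)$ for all $g\in G$ (and all $t$ and all admissible controls $u$); 2. $F\circ\varphi^i_t=\psi^i_t\circ F$ (for all $t\in\mathbb{R}$) and $dF_eZ_j(e)=W_j(e)$, for all $i,j=0,1,\ldots,m$.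
   Context: A vector field on a Lie group is called linear if its flow is a one-parameter group of automorphisms. Pairwise commuting means $[\mathcal{X}_i,\mathcal{X}_j]=0$ and $[\mathcal{Y}_i,\mathcal{Y}_j]=0$ for all $i,j=0,\ldots,m$. Here $e$ denotes the identity element of either group. Admissible controls $u=(u_1,\ldots,u_m):\mathbb{R}\to U\subset\mathbb{R}^m$ belong to a subset $\mathcal{U}\subset L^\infty_{loc}(\mathbb{R};\mathbb{R}^m)$.
   Formalization: The class of admissible controls is assumed nondegenerate: no nontrivial affine relation a_0 + a_1 u_1 + … + a_m u_m = 0 holds almost everywhere for all admissible u; for an arbitrary class, e.g. {0} or empty, condition 1 does not imply condition 2. *)

(* Defs.v *)
(* Smooth manifolds and Lie groups over an arbitrary R : realType, on top of
   MathComp and MathComp-Analysis. *)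
From HB Require Import structures.
From mathcomp Require Import all_boot all_order all_algebra.
From mathcomp Require Import all_classical all_reals all_analysis.
Set Implicit Arguments.
Unset Strict Implicit.
Unset Printing Implicit Defensive.
Import Order.TTheory GRing.Theory Num.Theory.
Import numFieldNormedType.Exports.
Local Open Scope classical_set_scope.
Local Open Scope ring_scope.

(* Only used for A open and V finite-dimensional, where differentiability
   together with C^r directional derivatives is the usual C^(r+1). *)
Fixpoint Ck_on (R : realType) (V W : normedModType R) (r : nat)
    (A : set V) (f : V -> W) : Prop :=
  if r is s.+1 then
    (forall x, A x -> differentiable f x) /\
    (forall v, Ck_on s A (fun x => 'D_v f x))
  else forall x, A x -> {for x, continuous f}.

Definition smooth_on (R : realType) (V W : normedModType R)
    (A : set V) (f : V -> W) : Prop := forall r, Ck_on r A f.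

(* [chart_inv c] is the inverse of [chart c] on [chart c @` chart_dom c]; the
   values of [chart c] off [chart_dom c] and of [chart_inv c] off that image
   are irrelevant. [chart_at p] is a preferred chart around p. *)
HB.mixin Record isManifold (R : realType) (n : nat) M of Topological M := {
  atlas : Type;
  chart_dom : atlas -> set M;
  chart : atlas -> M -> 'rV[R]_n;
  chart_inv : atlas -> 'rV[R]_n -> M;
  chart_at : M -> atlas;
  chart_atP : forall p, chart_dom (chart_at p) p;
  chart_dom_open : forall c, open (chart_dom c);
  chart_img_open : forall c, open (chart c @` chart_dom c);
  chartK : forall c p, chart_dom c p -> chart_inv c (chart c p) = p;
  chart_continuous : forall c p, chart_dom c p -> {for p, continuous (chart c)};
  chart_inv_continuous : forall c x,
    (chart c @` chart_dom c) x -> {for x, continuous (chart_inv c)};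
  transition_smooth : forall c d,
    smooth_on (chart c @` (chart_dom c `&` chart_dom d))
              (chart d \o chart_inv c);
  manifold_hausdorff : hausdorff_space M;
  manifold_second_countable : @second_countable M }.

#[short(type="manifoldType")]
HB.structure Definition Manifold (R : realType) (n : nat) :=
  { M of isManifold R n M & Topological M }.

Arguments atlas {R n} M : rename.

Definition smooth_map (R : realType) (n k : nat)
    (M : manifoldType R n) (N : manifoldType R k) (F : M -> N) : Prop :=
  continuous F /\
  forall (c : atlas M) (d : atlas N),
    smooth_on (chart c @` (chart_dom c `&` F @^-1` chart_dom d))
              (chart d \o F \o chart_inv c).

(* Smoothness of the multiplication is read in the product charts of G * G. *)
HB.mixin Record isLieGroup (R : realType) (n : nat) G
    of Manifold R n G & Group G := {
  mulg_continuous : continuous (fun z : G * G => (z.1 * z.2)%g);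
  mulg_smooth : forall b c d : atlas G,
    smooth_on
      [set z : ('rV[R]_n * 'rV[R]_n)%type |
        [/\ (chart b @` chart_dom b) z.1, (chart c @` chart_dom c) z.2 &
            chart_dom d (chart_inv b z.1 * chart_inv c z.2)%g]]
      (fun z : ('rV[R]_n * 'rV[R]_n)%type =>
         chart d (chart_inv b z.1 * chart_inv c z.2)%g);
  invg_smooth : smooth_map (fun g : G => g^-1%g) }.

#[short(type="lieGroupType")]
HB.structure Definition LieGroup (R : realType) (n : nat) :=
  { G of isLieGroup R n G & Manifold R n G & Group G }.

(* The tangent space at p is 'rV[R]_n: a tangent vector at p is given by its
   coordinates in the chart [chart_at p]. [tangent_map F p] is dF_p;
   [coords_in c p v] is v rewritten in the coordinates of another chart c. *)

Definition tangent_map (R : realType) (n k : nat)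
    (M : manifoldType R n) (N : manifoldType R k) (F : M -> N)
    (p : M) (v : 'rV[R]_n) : 'rV[R]_k :=
  'D_v (chart (chart_at (F p)) \o F \o chart_inv (chart_at p))
       (chart (chart_at p) p).

Definition coords_in (R : realType) (n : nat) (M : manifoldType R n)
    (c : atlas M) (p : M) (v : 'rV[R]_n) : 'rV[R]_n :=
  'D_v (chart c \o chart_inv (chart_at p)) (chart (chart_at p) p).

Definition field_in (R : realType) (n : nat) (M : manifoldType R n)
    (c : atlas M) (X : M -> 'rV[R]_n) (x : 'rV[R]_n) : 'rV[R]_n :=
  coords_in c (chart_inv c x) (X (chart_inv c x)).

Record vector_field (R : realType) (n : nat) (M : manifoldType R n) :=
  VectorField {
    vf_fun :> M -> 'rV[R]_n;
    vf_smooth : forall c : atlas M,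
      smooth_on (chart c @` chart_dom c) (field_in c vf_fun) }.

(* (DY)(X) - (DX)(Y) in the coordinates of [chart_at p] *)
Definition lie_bracket (R : realType) (n : nat) (M : manifoldType R n)
    (X Y : vector_field M) (p : M) : 'rV[R]_n :=
  let c := chart_at p in
  'D_(X p) (field_in c Y) (chart c p) - 'D_(Y p) (field_in c X) (chart c p).

Definition pairwise_commuting (R : realType) (n : nat) (M : manifoldType R n)
    (I : Type) (X : I -> vector_field M) : Prop :=
  forall i j p, lie_bracket (X i) (X j) p = 0.

Definition is_flow (R : realType) (n : nat) (M : manifoldType R n)
    (X : vector_field M) (phi : R -> M -> M) : Prop :=
  forall p, phi 0 p = p /\
    forall t, {for t, continuous (phi^~ p)} /\
      is_derive t (1 : R) (fun s => chart (chart_at (phi t p)) (phi s p))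
                (X (phi t p)).

Definition lie_hom (R : realType) (n k : nat)
    (G : lieGroupType R n) (H : lieGroupType R k) (F : G -> H) : Prop :=
  smooth_map F /\ {morph F : x y / (x * y)%g}.

Definition lie_automorphism (R : realType) (n : nat) (G : lieGroupType R n)
    (f : G -> G) : Prop :=
  lie_hom f /\ exists g : G -> G, [/\ lie_hom g, cancel f g & cancel g f].

Definition linear_field (R : realType) (n : nat) (G : lieGroupType R n)
    (X : vector_field G) : Prop :=
  exists phi : R -> G -> G,
    [/\ is_flow X phi,
        forall s t g, phi (s + t) g = phi s (phi t g) &
        forall t, lie_automorphism (phi t)].

Definition right_invariant (R : realType) (n : nat) (G : lieGroupType R n)
    (Z : vector_field G) : Prop :=
  forall a p : G, tangent_map (fun g => (g * a)%g) p (Z p) = Z (p * a)%g.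

(* (X_0 + Z_0)(g) + sum_(1 <= j <= m) w_j (X_j + Z_j)(g) *)
Definition affine_velocity (R : realType) (n m : nat) (G : lieGroupType R n)
    (X Z : 'I_m.+1 -> vector_field G) (w : 'rV[R]_m) (g : G) : 'rV[R]_n :=
  X ord0 g + Z ord0 g
  + \sum_(j < m) w ord0 j *: (X (lift ord0 j) g + Z (lift ord0 j) g).

(* Solutions on the whole line in the sense of Caratheodory: controls are only
   measurable, so dg/dt = V(u(t), g) is the integral equation in every chart,
   for every time interval during which the curve stays in the chart domain.
   For V affine in the control and a locally essentially bounded control, the
   integrand is measurable and essentially bounded, hence integrable. *)
Definition is_solution (R : realType) (n m : nat) (M : manifoldType R n)
    (V : 'rV[R]_m -> M -> 'rV[R]_n) (u : R -> 'rV[R]_m) (gamma : R -> M) : Prop :=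
  continuous gamma /\
  forall (c : atlas M) (a b : R), a <= b ->
    (forall s, a <= s <= b -> chart_dom c (gamma s)) ->
    forall k : 'I_n,
      chart c (gamma b) ord0 k - chart c (gamma a) ord0 k =
      \int[@lebesgue_measure R]_(s in `[a, b])
        (coords_in c (gamma s) (V (u s) (gamma s)) ord0 k).

Definition solution_map (R : realType) (n m : nat) (M : manifoldType R n)
    (V : 'rV[R]_m -> M -> 'rV[R]_n) (Adm : set (R -> 'rV[R]_m))
    (phi : R -> M -> (R -> 'rV[R]_m) -> M) : Prop :=
  forall g u, Adm u -> phi 0 g u = g /\ is_solution V u (fun t => phi t g u).

Definition Linfty_loc (R : realType) (m : nat) (u : R -> 'rV[R]_m) : Prop :=
  (forall j, measurable_fun [set: R] (fun t => u t ord0 j)) /\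
  forall a b : R, exists B : R,
    {ae @lebesgue_measure R, forall t, a <= t <= b -> `|u t| <= B}.

Definition admissible_class (R : realType) (m : nat)
    (U : set 'rV[R]_m) (Adm : set (R -> 'rV[R]_m)) : Prop :=
  forall u, Adm u -> Linfty_loc u /\ forall t, U (u t).

(* 1, u_1, ..., u_m are linearly independent over the class, i.e. no proper
   affine subspace of R^m contains almost all values of all admissible
   controls. When this fails, the trajectories do not determine the individual
   fields X_j + Z_j: if the class is {0}, nothing depends on X_j, Z_j, j > 0. *)
Definition nondegenerate_class (R : realType) (m : nat)
    (Adm : set (R -> 'rV[R]_m)) : Prop :=
  forall (a0 : R) (a : 'rV[R]_m),
    (forall u, Adm u ->
       {ae @lebesgue_measure R, forall t,
          a0 + \sum_(j < m) a ord0 j * u t ord0 j = 0}) ->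
    a0 = 0 /\ a = 0.

(* Main.v *)
Require Import Defs.
From mathcomp Require Import all_boot all_order all_algebra.
From mathcomp Require Import all_classical all_reals all_analysis.
From mathcomp Require Import measurable_realfun ring lra.
Local Open Scope classical_set_scope.
Local Open Scope ring_scope.

(** Both conditions say that F intertwines the two systems, the first for the
trajectories and the second for the fields; the work lies in reading the fields
off the trajectories of merely measurable controls.

Trajectories are described by one first-order expansion. If U_0(t) = t and
U_j(t) is the integral of u_j from 0 to t, a trajectory satisfies, in a chart
and at every time t,
  x(s) - x(t) = sum_j (U_j(s) - U_j(t)) (X_j + Z_j)(x(t)) + o(s - t),
because the fields are continuous along the curve and the control is essentially
bounded ([solution_has_mder]). Such expansions obey the chain rule
([has_mder_comp]), and the inequalities that they give for norms suffice for a
Gronwall lemma ([gronwall]).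

Right translation moves velocities to the tangent space at the identity. There
Z_j becomes constant, and a linear field X_j becomes a function x_j with
  x_j(h) = Ad(g^-1) (x_j(gh) - x_j(g))  ([linear_field_cocycle]).
Hence the quotient gamma^-1 eta of two trajectories of the affine system with
the same control is a trajectory of the system of the linear fields alone
([quotient_solves]). The identity is an equilibrium of that system, and Gronwall
in the chart at the identity shows that a solution that starts there stays there
([linear_system_unique]): trajectories of the affine system are determined by
their initial point.

If F intertwines the flows and the vectors Z_j(e), W_j(e), then F maps the
velocities of phi to those of theta, and uniqueness gives the first condition
([conjugate_of_related]).

Conversely, put E_j = dF x_j - y_j F ([defect]) and d_j = dF Z_j(e) - W_j(e).
Comparing velocities at the times at which all the U_j are differentiable, which
are almost all times, gives sum_j u_j(t) (E_j + d_j) = 0 (with u_0 = 1) at all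
points phi_t(g, u) ([ae_defect]). The E_j satisfy a cocycle identity like that of
the x_j, so sum_j u_j(t) E_j vanishes on the points chi_t(g), where chi is the system of the
linear fields. Now chi_t fixes the identity, and the Gronwall estimates, run
forward and backward in time, show that it is linear to first order there and
bounded below; its image thus meets all directions, and the linear part of
sum_j u_j(t) E_j at the identity is 0 ([linearized_span]). Nondegeneracy of the
class of controls separates the indices: each E_j has linear part 0 at the
identity. A cocycle with this property has derivative 0 everywhere, hence
vanishes on the connected group G ([cocycle_eq0]), and then the d_j vanish by
nondegeneracy again ([related_of_conjugate]). *)

Set Implicit Arguments.
Unset Strict Implicit.
Unset Printing Implicit Defensive.
Import Order.TTheory GRing.Theory Num.Theory.
Import numFieldNormedType.Exports.

(** * Differential inequalities and derivatives along several Lipschitz clocks *)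

(** Induction along an interval: the supremum of the times up to which P holds
belongs to P by the limit clause, and is T since otherwise the step clause
would pass it. *)
Lemma continuous_induction (R : realType) (T : R) (P : R -> Prop) :
  0 <= T -> P 0 ->
  (forall t, 0 <= t < T -> P t -> exists2 d, 0 < d &
     forall s, t < s < t + d -> P s) ->
  (forall t, 0 < t <= T -> (forall s, 0 <= s < t -> P s) -> P t) ->
  forall t, 0 <= t <= T -> P t.
Proof.
move=> T0 P0 Pr Pl.
pose A := [set t | 0 <= t <= T /\ forall s, 0 <= s <= t -> P s].
have A0 : A 0.
  split; first by rewrite lexx T0.
  by move=> s /le_anti <-.
have ubA : ubound A T by move=> t [/andP[]].
have hsA : has_sup A by split; [exists 0 | exists T].
set c := sup A.
have c0 : 0 <= c by apply: ub_le_sup => //; exists T.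
have cT : c <= T by apply: ge_sup => //; exists 0.
have Pc s : 0 <= s < c -> P s.
  move=> /andP[s0 sc].
  have [t [_ At] st] : exists2 t, A t & s < t.
    have [t At st] := sup_adherent (eps := c - s) (ltac:(by rewrite subr_gt0)) hsA.
    by exists t => //; move: st; rewrite -/c; lra.
  by apply: At; rewrite s0 ltW.
have Pcc : P c.
  move: c0; rewrite le_eqVlt => /orP[/eqP <- // | cgt0].
  by apply: Pl => //; rewrite cgt0.
have cE : c = T.
  apply/eqP; rewrite eq_le cT /= leNgt; apply/negP => cltT.
  have [|d d0 Hd] := Pr c _ Pcc; first by rewrite c0.
  pose e := Num.min (d / 2) (T - c).
  have e0 : 0 < e by rewrite lt_min; apply/andP; split; lra.
  have ed : e <= d / 2 by rewrite ge_min lexx.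
  have eT : e <= T - c by rewrite ge_min lexx orbT.
  have : c + e <= c; last by lra.
  apply: ub_le_sup; first by exists T.
  split; first by apply/andP; split; lra.
  move=> s /andP[s0 se].
  have [sc|cs|->//] := ltgtP s c; first by apply: Pc; rewrite s0.
  by apply: Hd; apply/andP; split => //; lra.
move=> t /andP[t0]; rewrite -cE le_eqVlt => /orP[/eqP -> // | tc].
by apply: Pc; rewrite t0.
Qed.

(** The bound B exp((C + 2) t) is a barrier: its slope exceeds that of any f with
f' <= C f + B by at least its own value, which leaves room for the error term e.
The side condition Q lets f be a distance that is only meaningful while a curve
stays in a chart: Q propagates along with the bound, and the limit clause may use
the bound to recover it. *)
Lemma gronwall (R : realType) (T C B : R) (f : R -> R) (Q : R -> Prop) :
  0 <= T -> 0 <= C -> 0 < B -> Q 0 -> f 0 <= B ->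
  (forall t, 0 <= t < T -> Q t -> f t <= B * expR ((C + 2) * t) ->
     forall e, 0 < e -> exists2 d, 0 < d &
       forall s, t < s < t + d ->
         Q s /\ f s <= f t + (s - t) * (C * `|f t| + B + e)) ->
  (forall t, 0 <= t -> 0 <= f t) ->
  (forall t, 0 < t <= T ->
     (forall s, 0 <= s < t -> Q s /\ f s <= B * expR ((C + 2) * s)) ->
     Q t /\ f t <= B * expR ((C + 2) * t)) ->
  forall t, 0 <= t <= T -> Q t /\ f t <= B * expR ((C + 2) * t).
Proof.
move=> T0 C0 B0 Q0 f0 Hr fge0 Hl.
apply: (continuous_induction T0) => //.
  by rewrite mulr0 expR0 mulr1.
move=> t tT [Qt ft].
have t0 : 0 <= t by case/andP: tT.
set b := B * _ in ft.
have Bb : B <= b.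
  rewrite /b ler_peMr ?(ltW B0) // -[leLHS]expR0 ler_expR mulr_ge0 //; lra.
have [d d0 Hd] := Hr t tT Qt ft b (lt_le_trans B0 Bb).
exists d => // s sd; have [Qs fs] := Hd s sd; split => //.
apply: (le_trans fs).
have st : 0 < s - t by lra.
have -> : (C + 2) * s = (C + 2) * t + (C + 2) * (s - t) by ring.
rewrite expRD mulrA -/b.
apply: (@le_trans _ _ (b * (1 + (C + 2) * (s - t)))); last first.
  by rewrite ler_wpM2l ?expR_ge1Dx //; lra.
have -> : b * (1 + (C + 2) * (s - t)) = b + (s - t) * (C * b + b + b) by ring.
rewrite lerD // ler_wpM2l; [by []|lra|].
have Cf : C * `|f t| <= C * b by rewrite ler_wpM2l // ger0_norm ?fge0.
by lra.
Qed.

Section Diff.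
Variables (R : realType) (V W : normedModType R).

Lemma diff_approx (f : V -> W) a : differentiable f a ->
  forall e : R, 0 < e ->
  \forall x \near a, `|f x - f a - 'd f a (x - a)| <= e * `|x - a|.
Proof.
move=> df e e0; have := diff_locallyx df => fE.
have : \forall h \near (0 : V), `|f (h + a) - f a - 'd f a h| <= e * `|h|.
  near=> h.
  rewrite fE -addrA -opprD [X in `|X|]addrC addKr.
  near: h; exact: littleoP.
rewrite (near_shift a) /= => H; near=> x.
rewrite -{1}(subrK a x); near: x.
by apply: filterS H => x /=; rewrite sub0r.
Unshelve. all: by end_near. Qed.

Lemma diff_bound (f : V -> W) a : differentiable f a ->
  exists2 K : R, 0 < K & forall v, `|'d f a v| <= K * `|v|.
Proof. by move=> df; apply: linear_lipschitz; exact: diff_continuous. Qed.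

End Diff.

Section Mder.
Variables (R : realType) (J : finType) (U : J -> R -> R).

(** The derivative of a curve with respect to several clocks U_j at once. For the
single clock U t = t this is the usual derivative; for primitives of measurable
controls it makes sense at every time, even when the curve has no derivative.
The v_j need not be unique. *)
Definition has_mder (V : normedModType R) (x : R -> V) (t : R) (v : J -> V) :=
  forall e : R, 0 < e -> \forall s \near t,
    `|x s - x t - \sum_j (U j s - U j t) *: v j| <= e * `|s - t|.

Definition lip_at (t : R) := exists2 K : R, 0 < K &
  \forall s \near t, forall j, `|U j s - U j t| <= K * `|s - t|.

Lemma sum_mder_bound (V : normedModType R) (v : J -> V) (K h : R) (a : J -> R) :
  0 <= K -> (forall j, `|a j| <= K * h) ->
  `|\sum_j a j *: v j| <= K * h * \sum_j `|v j|.
Proof.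
move=> K0 aK; rewrite mulr_sumr; apply: (le_trans (ler_norm_sum _ _ _)).
by apply: ler_sum => j _; rewrite normrZ ler_wpM2r.
Qed.

Lemma has_mder_growth (V : normedModType R) (x : R -> V) t v :
  lip_at t -> has_mder x t v ->
  exists2 C : R, 0 < C & \forall s \near t, `|x s - x t| <= C * `|s - t|.
Proof.
move=> [K K0 UK] dx; exists (1 + K * \sum_j `|v j|).
  by rewrite ltr_pwDl // mulr_ge0 ?(ltW K0) // sumr_ge0.
near=> s.
have sK : forall j, `|U j s - U j t| <= K * `|s - t| by near: s.
have ds : `|x s - x t - \sum_j (U j s - U j t) *: v j| <= 1 * `|s - t|.
  by near: s; exact: dx.
rewrite -[x s - x t](subrK (\sum_j (U j s - U j t) *: v j)).
apply: (le_trans (ler_normD _ _)); rewrite mulrDl lerD //.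
by rewrite mulrAC; apply: sum_mder_bound => //; exact: ltW.
Unshelve. all: by end_near. Qed.

Lemma has_mder_cont (V : normedModType R) (x : R -> V) t v :
  lip_at t -> has_mder x t v -> {for t, continuous x}.
Proof.
move=> lt dx; have [C C0 xC] := has_mder_growth lt dx.
apply/cvgrPdist_le => e e0; near=> s.
rewrite distrC; apply: (@le_trans _ _ (C * `|s - t|)); first by near: s.
rewrite -ler_pdivlMl // distrC; near: s.
apply: cvgr_dist_le; first exact: cvg_id.
by rewrite mulr_gt0 ?invr_gt0.
Unshelve. all: by end_near. Qed.

Lemma has_mder_comp (V W : normedModType R) (f : V -> W) (x : R -> V) t v :
  lip_at t -> has_mder x t v -> differentiable f (x t) ->
  has_mder (f \o x) t (fun j => 'd f (x t) (v j)).
Proof.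
move=> lt dx df e e0.
have [C C0 xC] := has_mder_growth lt dx.
have [K K0 dK] := diff_bound df.
have cx := has_mder_cont lt dx.
near=> s => /=.
have H1 : `|f (x s) - f (x t) - 'd f (x t) (x s - x t)| <= e / (2 * C) * `|x s - x t|.
  near: s; apply: (cx _ (diff_approx df _)); rewrite divr_gt0 // mulr_gt0 //.
have H2 : `|x s - x t - \sum_j (U j s - U j t) *: v j| <= e / (2 * K) * `|s - t|.
  by near: s; apply: dx; rewrite divr_gt0 // mulr_gt0.
have H3 : `|x s - x t| <= C * `|s - t| by near: s.
have -> : \sum_j (U j s - U j t) *: 'd f (x t) (v j) =
          'd f (x t) (\sum_j (U j s - U j t) *: v j).
  by rewrite linear_sum; apply: eq_bigr => j _; rewrite linearZ.
have -> : f (x s) - f (x t) - 'd f (x t) (\sum_j (U j s - U j t) *: v j) =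
   (f (x s) - f (x t) - 'd f (x t) (x s - x t)) +
   'd f (x t) (x s - x t - \sum_j (U j s - U j t) *: v j).
  by rewrite (linearB ('d f (x t)) (x s - x t)) addrA subrK.
apply: (le_trans (ler_normD _ _)).
have -> : e * `|s - t| = e / (2 * C) * (C * `|s - t|) + K * (e / (2 * K) * `|s - t|).
  by field; rewrite !gt_eqF.
apply: lerD.
  by apply: (le_trans H1); rewrite ler_wpM2l // divr_ge0 ?mulr_ge0 ?ltW.
by apply: (le_trans (dK _)); rewrite ler_wpM2l // ltW.
Unshelve. all: by end_near. Qed.

Lemma has_mder_near (V : normedModType R) (x y : R -> V) t v :
  (\forall s \near t, x s = y s) -> has_mder x t v -> has_mder y t v.
Proof.
move=> xy dx e e0; have xyt := nbhs_singleton xy.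
by apply: filterS2 xy (dx _ e0) => s <-; rewrite xyt.
Qed.

Lemma has_mder_pair (V W : normedModType R) (x : R -> V) (y : R -> W) t v w :
  has_mder x t v -> has_mder y t w ->
  has_mder (fun s => (x s, y s)) t (fun j => (v j, w j)).
Proof.
move=> dx dy e e0; near=> s.
have -> : \sum_j (U j s - U j t) *: (v j, w j) =
   (\sum_j (U j s - U j t) *: v j, \sum_j (U j s - U j t) *: w j).
  by elim/big_rec3 : _ => // j a b c _ ->.
rewrite prod_normE /= ge_max; apply/andP; split; near: s.
  exact: dx.
exact: dy.
Unshelve. all: by end_near. Qed.

Lemma has_mder_lin (V : normedModType R) (I : finType) (a : I -> R)
    (x : I -> R -> V) t v :
  (forall i, has_mder (x i) t (v i)) ->
  has_mder (fun s => \sum_i a i *: x i s) t (fun j => \sum_i a i *: v i j).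
Proof.
move=> dx e e0.
pose A := 1 + \sum_i `|a i|.
have A0 : 0 < A by rewrite ltr_pwDl // sumr_ge0.
have dxi : \forall s \near t, forall i,
   `|x i s - x i t - \sum_j (U j s - U j t) *: v i j| <= e / A * `|s - t|.
  by apply: filter_forall (fun i => dx i _ (divr_gt0 e0 A0)).
near=> s.
have -> : \sum_i a i *: x i s - \sum_i a i *: x i t -
     \sum_j (U j s - U j t) *: (\sum_i a i *: v i j) =
   \sum_i a i *: (x i s - x i t - \sum_j (U j s - U j t) *: v i j).
  under [RHS]eq_bigr do rewrite !scalerBr.
  rewrite !sumrB; congr (_ - _).
  under eq_bigr do rewrite scaler_sumr.
  rewrite exchange_big; apply: eq_bigr => i _; rewrite scaler_sumr.
  by apply: eq_bigr => j _; rewrite !scalerA mulrC.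
apply: (le_trans (ler_norm_sum _ _ _)).
apply: (@le_trans _ _ (\sum_i `|a i| * (e / A * `|s - t|))).
  apply: ler_sum => i _; rewrite normrZ ler_wpM2l //.
  have H : forall i,
   `|x i s - x i t - \sum_j (U j s - U j t) *: v i j| <= e / A * `|s - t|.
    by near: s.
  exact: H.
rewrite -mulr_suml.
have -> : e * `|s - t| = A * (e / A * `|s - t|) by field; rewrite gt_eqF.
apply: ler_wpM2r; first by rewrite mulr_ge0 // divr_ge0 ?ltW.
by rewrite /A lerDr.
Unshelve. all: by end_near. Qed.

Lemma has_mder_norm_le (V : normedModType R) (x : R -> V) t v (K : R) :
  0 <= K -> (\forall s \near t, forall j, `|U j s - U j t| <= K * `|s - t|) ->
  has_mder x t v -> forall e : R, 0 < e ->
  \forall s \near t, `|x s| <= `|x t| + `|s - t| * (K * (\sum_j `|v j|) + e).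
Proof.
move=> K0 UK dx e e0; near=> s.
have sK : forall j, `|U j s - U j t| <= K * `|s - t| by near: s.
have ds : `|x s - x t - \sum_j (U j s - U j t) *: v j| <= e * `|s - t|.
  by near: s; exact: dx.
have -> : x s = x t + (\sum_j (U j s - U j t) *: v j +
   (x s - x t - \sum_j (U j s - U j t) *: v j)).
  by rewrite [\sum_j _ + _]addrC subrK addrC subrK.
apply: (le_trans (ler_normD _ _)); rewrite lerD2l.
apply: (le_trans (ler_normD _ _)); rewrite mulrDr lerD //; last by rewrite mulrC.
by rewrite mulrA [_ * K]mulrC; exact: sum_mder_bound.
Unshelve. all: by end_near. Qed.

(** At a time where the clocks have derivatives u_j, the combination of the v_j
with weights u_j is the ordinary velocity of the curve. *)
Lemma has_mder_unique (V : normedModType R) (x : R -> V) t v w (u : J -> R) :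
  (forall j (e : R), 0 < e ->
     \forall s \near t, `|U j s - U j t - (s - t) * u j| <= e * `|s - t|) ->
  has_mder x t v -> has_mder x t w -> \sum_j u j *: v j = \sum_j u j *: w j.
Proof.
move=> Uu dv dw; apply/eqP; rewrite -subr_eq0 -normr_le0; apply/ler_addgt0Pr => e e0.
rewrite add0r.
pose A := 2 + \sum_j `|v j - w j|.
have A0 : 0 < A by rewrite ltr_pwDl // sumr_ge0.
have eA : 0 < e / A by rewrite divr_gt0.
have Un : \forall s \near t, forall j,
    `|U j s - U j t - (s - t) * u j| <= e / A * `|s - t|.
  exact: filter_forall (fun j => Uu j _ eA).
have [d /= d0 Hd] := (@nbhs_ballP R _ t _).1 (filterI Un (filterI (dv _ eA) (dw _ eA))).
pose s := t + d / 2.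
have st : s - t = d / 2 by rewrite /s; ring.
have [|U1 [v1 w1]] := Hd s.
  by rewrite /ball /= distrC st gtr0_norm; lra.
have h0 : 0 < s - t by rewrite st; lra.
have nh : `|s - t| = s - t by rewrite gtr0_norm.
rewrite -(ler_pM2l h0) -{1}nh -normrZ.
have -> : (s - t) *: (\sum_j u j *: v j - \sum_j u j *: w j) =
   (x s - x t - \sum_j (U j s - U j t) *: w j) -
   (x s - x t - \sum_j (U j s - U j t) *: v j) -
   \sum_j (U j s - U j t - (s - t) * u j) *: (v j - w j).
  have subBB (a b c : V) : (a - b) - (a - c) = c - b.
    by rewrite opprB addrC addrA subrK.
  rewrite subBB.
  rewrite -!sumrB scaler_sumr; apply: eq_bigr => j _.
  by rewrite -!scalerBr [(_ - _ * _) *: _]scalerBl scalerA opprB [RHS]addrC subrK.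
apply: (le_trans (ler_normB _ _)).
apply: (@le_trans _ _ (e / A * `|s - t| * 2 + e / A * `|s - t| * \sum_j `|v j - w j|)).
  apply: lerD; last by apply: sum_mder_bound => //; exact: ltW.
  by rewrite mulr_natr mulr2n; apply: (le_trans (ler_normB _ _)); exact: lerD.
rewrite -mulrDr -/A nh.
have -> : e / A * (s - t) * A = (s - t) * e by field; rewrite gt_eqF.
by [].
Qed.

End Mder.

Lemma is_derive_approx (R : realType) (V : normedModType R) (f : R -> V) (t : R) df :
  is_derive t (1 : R) f df -> forall e : R, 0 < e ->
  \forall s \near t, `|f s - f t - (s - t) *: df| <= e * `|s - t|.
Proof.
move=> [Df fE] e e0.
have df1 := (@derivable1_diffP _ _ f t).1 Df.
have := diff_approx df1 e0.
by apply: filterS => s; rewrite (diff1E df1) /= derive1E fE.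
Qed.

Section DiffPair.
Variables (R : realType) (V W X Y : normedModType R).

Lemma diff_comp_pair (f : W * X -> Y) (i : V -> W) (j : V -> X) a v :
  differentiable i a -> differentiable j a -> differentiable f (i a, j a) ->
  'd (fun x => f (i x, j x)) a v = 'd f (i a, j a) ('d i a v, 'd j a v).
Proof.
move=> di dj df.
have dp := differentiable_pair di dj.
by rewrite -[LHS]/('d (f \o (fun x => (i x, j x))) a v) diff_comp //= diff_pair.
Qed.

Lemma diffid (a v : V) : 'd id a v = v.
Proof. by rewrite diff_val. Qed.

Lemma diffcst (b : W) (a v : V) : 'd (fun=> b) a v = 0.
Proof. by rewrite (diff_cst b a). Qed.

End DiffPair.

(** * Differentiability on manifolds, and the local group law *)

(** Differentiability is local; the expansions of f and g at a coincide. *)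
Lemma diff_near (R : realType) (V W : normedModType R) (f g : V -> W) a :
  (\forall x \near a, f x = g x) -> differentiable f a ->
  differentiable g a /\ 'd g a = 'd f a :> (V -> W).
Proof.
move=> fg df; have fga := nbhs_singleton fg.
have gE : g \o shift a = cst (g a) + 'd f a +o_ 0 id.
  apply/eqaddoP => e e0.
  have H : \forall x \near a, `|g x - g a - 'd f a (x - a)| <= e * `|x - a|.
    by apply: filterS2 fg (diff_approx df e0) => x <-; rewrite fga.
  move: H; rewrite (near_shift 0) => H.
  apply: filterS H => h /=; rewrite subr0 addrK opprD addrA.
  by [].
have dgE : 'd g a = 'd f a :> (V -> W).
  by apply: diff_unique => //; exact: diff_continuous.
split=> //; apply/diff_locallyP; rewrite dgE; split => //.
exact: diff_continuous.
Qed.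

Section LocalGroupLaw.
Variables (R : realType) (V : normedModType R) (o : V) (f : V * V -> V).
Hypothesis df : differentiable f (o, o).
Hypothesis f1 : \forall x \near o, f (x, o) = x.
Hypothesis f2 : \forall x \near o, f (o, x) = x.

(** The differential of a product at the unit is the sum, since it restricts to the
identity on each factor. *)
Lemma diff_local_mul v w : 'd f (o, o) (v, w) = v + w.
Proof.
have did : differentiable id o by exact: ex_diff.
have dcst : differentiable (fun _ : V => o) o by exact: differentiable_cst.
have vw : (v, w) = (v, 0) + (0, w) :> V * V.
  by rewrite -[RHS]/(v + 0, 0 + w) addr0 add0r.
have sym (g : V -> V) : (\forall x \near o, g x = x) -> forall u, 'd g o u = u.
  move=> ge u; have gi : \forall x \near o, id x = g x.
    by apply: filterS ge => x gx; exact: esym.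
  have [_ ->] := diff_near gi did. exact: diffid.
rewrite vw linearD /=; congr (_ + _).
- by rewrite -[RHS](sym _ f1 v) (diff_comp_pair v did dcst df) diffid diffcst.
- by rewrite -[RHS](sym _ f2 w) (diff_comp_pair w dcst did df) diffid diffcst.
Qed.

Lemma diff_local_inv (i : V -> V) v : differentiable i o -> i o = o ->
  (\forall x \near o, f (x, i x) = o) -> 'd i o v = - v.
Proof.
move=> di io fi.
have did : differentiable id o by exact: ex_diff.
have df' : differentiable f (id o, i o) by rewrite io.
have fi' : \forall x \near o, (fun=> o) x = (fun x => f (x, i x)) x.
  by apply: filterS fi => x ->.
have [_ dE] := diff_near fi' (differentiable_cst o o).
have d0 : 'd (fun x => f (x, i x)) o v = 0 by rewrite dE; exact: diffcst.
have : 'd f (o, i o) ('d id o v, 'd i o v) = 0.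
  exact: etrans (esym (diff_comp_pair v did di df')) d0.
rewrite (diffid o v) io diff_local_mul => /eqP.
by rewrite addrC addr_eq0 => /eqP.
Qed.

End LocalGroupLaw.

Section Manifold.
Variables (R : realType) (n : nat) (M : manifoldType R n).
Implicit Types (c d : atlas M) (p : M).

Lemma chart_dom_near c p : chart_dom c p -> \forall q \near p, chart_dom c q.
Proof. by move=> cp; apply: open_nbhs_nbhs; split => //; exact: chart_dom_open. Qed.

Lemma chart_img_near c p : chart_dom c p ->
  \forall x \near chart c p, (chart c @` chart_dom c) x.
Proof.
by move=> cp; apply: open_nbhs_nbhs; split; [exact: chart_img_open | exists p].
Qed.

Lemma chart_invK c x : (chart c @` chart_dom c) x ->
  chart_dom c (chart_inv c x) /\ chart c (chart_inv c x) = x.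
Proof. by move=> [q cq <-]; rewrite chartK. Qed.

Lemma chart_inv_cont c p : chart_dom c p ->
  chart_inv c x @[x --> chart c p] --> p.
Proof.
move=> cp; rewrite -[X in _ --> X](chartK _ _ cp).
by apply: (@chart_inv_continuous _ _ M c (chart c p)); exists p.
Qed.

End Manifold.

Section DiffIn.
Variables (R : realType) (n k : nat) (M : manifoldType R n) (N : manifoldType R k).

(** The derivative is read in arbitrary charts c and d rather than the preferred
ones, so that curves near the identity can stay in a single chart. *)
Definition diff_in (c : atlas M) (d : atlas N) (F : M -> N) (p : M) :=
  [/\ chart_dom c p, chart_dom d (F p), {for p, continuous F} &
      differentiable (chart d \o F \o chart_inv c) (chart c p)].

Definition D_in (c : atlas M) (d : atlas N) (F : M -> N) (p : M) :
   'rV[R]_n -> 'rV[R]_k := 'd (chart d \o F \o chart_inv c) (chart c p).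

Lemma D_inE c d F p v : diff_in c d F p ->
  'D_v (chart d \o F \o chart_inv c) (chart c p) = D_in c d F p v.
Proof. by move=> [_ _ _ df]; rewrite deriveE. Qed.

Lemma smooth_map_diff_in c d F p : smooth_map F -> chart_dom c p ->
  chart_dom d (F p) -> diff_in c d F p.
Proof.
move=> [cF /(_ c d 1%N) [sF _]] cp dp; split => //; first exact: cF.
by apply: sF; exists p.
Qed.

End DiffIn.

Section DiffInComp.
Variables (R : realType) (n k l : nat) (M : manifoldType R n)
  (N : manifoldType R k) (P : manifoldType R l).

Lemma diff_in_comp c d e (F : M -> N) (G : N -> P) p :
  diff_in c d F p -> diff_in d e G (F p) ->
  diff_in c e (G \o F) p /\
  forall v, D_in c e (G \o F) p v = D_in d e G (F p) (D_in c d F p v).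
Proof.
move=> [cp dF cF dfF] [_ eG cG dfG].
have E1 : (chart d \o F \o chart_inv c) (chart c p) = chart d (F p).
  by rewrite /= chartK.
have dfG' : differentiable (chart e \o G \o chart_inv d)
      ((chart d \o F \o chart_inv c) (chart c p)) by rewrite E1.
have dcmp := differentiable_comp dfF dfG'.
have nE : \forall x \near chart c p,
   ((chart e \o G \o chart_inv d) \o (chart d \o F \o chart_inv c)) x =
   (chart e \o (G \o F) \o chart_inv c) x.
  have Fc : F (chart_inv c x) @[x --> chart c p] --> F p.
    exact: cvg_comp (chart_inv_cont cp) cF.
  have Fd : \forall x \near chart c p, chart_dom d (F (chart_inv c x)).
    exact: Fc _ (chart_dom_near dF).
  by apply: filterS Fd => x /= dx; rewrite chartK.
have [dn dnE] := diff_near nE dcmp.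
split.
  by split; [exact: cp|exact: eG|exact: (continuous_comp cF cG)|exact: dn].
move=> v; rewrite /D_in dnE (diff_comp dfF dfG').
by rewrite -[in RHS]E1.
Qed.

End DiffInComp.

Section Group.
Variables (R : realType) (n : nat) (G : lieGroupType R n).
Implicit Types (a p q : G) (b c d : atlas G).

Local Notation c1 := (chart_at (1%g : G)).

Lemma mul_cvg (T : Type) (Fl : set_system T) (f g : T -> G) p q :
  Filter Fl -> f x @[x --> Fl] --> p -> g x @[x --> Fl] --> q ->
  (f x * g x)%g @[x --> Fl] --> (p * q)%g.
Proof.
move=> FF fp gq.
have h : (fun x => (f x, g x)) @ Fl --> ((p, q) : G * G) by exact: cvg_pair.
exact: (cvg_comp _ _ h (@mulg_continuous _ _ G (p, q))).
Qed.

Lemma inv_cvg (T : Type) (Fl : set_system T) (f : T -> G) p :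
  Filter Fl -> f x @[x --> Fl] --> p -> (f x)^-1%g @[x --> Fl] --> p^-1%g.
Proof. by move=> FF fp; apply: cvg_comp fp _; exact: (invg_smooth (s := G)).1. Qed.

Definition chart_mul b c d (z : 'rV[R]_n * 'rV[R]_n) : 'rV[R]_n :=
  chart d (chart_inv b z.1 * chart_inv c z.2 : G)%g.

Lemma chart_mul_diff b c d p q : chart_dom b p -> chart_dom c q ->
  chart_dom d (p * q)%g -> differentiable (chart_mul b c d) (chart b p, chart c q).
Proof.
move=> bp cq dpq; have [sm _] := @mulg_smooth _ _ G b c d 1%N.
apply: sm; split => /=; [by exists p|by exists q|].
by rewrite !chartK.
Qed.

Lemma right_diff_in c d a p : chart_dom c p -> chart_dom d (p * a)%g ->
  diff_in c d (fun g : G => g * a)%g p.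
Proof.
move=> cp dpa; split => //.
  by apply: mul_cvg; [exact: cvg_id | exact: cvg_cst].
have ca := chart_atP a.
have -> : (chart d \o (fun g : G => g * a)%g \o chart_inv c) =
    chart_mul c (chart_at a) d \o (fun x => (x, chart (chart_at a) a)).
  by apply/funext => x; rewrite /chart_mul /= chartK.
apply: differentiable_comp; last exact: chart_mul_diff.
by apply: differentiable_pair; [exact: ex_diff | exact: differentiable_cst].
Qed.

Lemma left_diff_in c d a p : chart_dom c p -> chart_dom d (a * p)%g ->
  diff_in c d (fun g : G => a * g)%g p.
Proof.
move=> cp dpa; split => //.
  by apply: mul_cvg; [exact: cvg_cst | exact: cvg_id].
have ca := chart_atP a.
have -> : (chart d \o (fun g : G => a * g)%g \o chart_inv c) =
    chart_mul (chart_at a) c d \o (fun x => (chart (chart_at a) a, x)).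
  by apply/funext => x; rewrite /chart_mul /= chartK.
apply: differentiable_comp; last exact: chart_mul_diff.
by apply: differentiable_pair; [exact: differentiable_cst | exact: ex_diff].
Qed.

Lemma conj_diff_in a : diff_in c1 c1 (fun g : G => a * g * a^-1)%g 1%g.
Proof.
have c11 := chart_atP (1%g : G).
have la := @left_diff_in c1 (chart_at (a * 1)%g) a 1%g c11 (chart_atP _).
have ra : diff_in (chart_at (a * 1)%g) c1 (fun g : G => g * a^-1)%g (a * 1)%g.
  apply: right_diff_in; first exact: chart_atP.
  by rewrite mulg1 mulgV.
by have [] := diff_in_comp la ra.
Qed.

(** The adjoint action in the coordinates of the chart at the identity. *)
Definition Ad a : 'rV[R]_n -> 'rV[R]_n := D_in c1 c1 (fun g : G => a * g * a^-1)%g 1%g.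

Lemma AdB a v w : Ad a (v - w) = Ad a v - Ad a w.
Proof. by rewrite /Ad /D_in linearB. Qed.

Lemma AdZ a (r : R) v : Ad a (r *: v) = r *: Ad a v.
Proof. by rewrite /Ad /D_in linearZ. Qed.

Lemma Ad_sum a (I : finType) (v : I -> 'rV[R]_n) : Ad a (\sum_i v i) = \sum_i Ad a (v i).
Proof. by rewrite /Ad /D_in linear_sum. Qed.

Lemma D_in_id c p v : chart_dom c p -> D_in c c (fun g : G => g) p v = v.
Proof.
move=> cp.
have nE : \forall x \near chart c p, id x = (chart c \o id \o chart_inv c) x.
  by apply: filterS (chart_img_near cp) => x /= /chart_invK[].
have [_ dE] := diff_near nE (ex_diff : differentiable id (chart c p)).
by rewrite /D_in dE diff_val.
Qed.

Lemma AdK a : cancel (Ad a) (Ad a^-1%g).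
Proof.
move=> v.
have ca := conj_diff_in a.
have cV : diff_in c1 c1 (fun g : G => a^-1 * g * a^-1^-1)%g ((fun g : G => a * g * a^-1)%g 1%g).
  by rewrite /= mulg1 mulgV; exact: conj_diff_in.
have [_ E] := diff_in_comp ca cV.
have FE : (fun g : G => a^-1 * g * a^-1^-1)%g \o (fun g : G => a * g * a^-1)%g = (fun g => g).
  by apply/funext => g /=; rewrite invgK !mulgA mulVg mul1g mulgVK.
have := E v; rewrite mulg1 mulgV FE D_in_id; last exact: chart_atP.
by move=> vE; rewrite /Ad [RHS]vE.
Qed.

Lemma chart_mul_diff1 v w : 'd (chart_mul c1 c1 c1) (chart c1 1%g, chart c1 1%g) (v, w) = v + w.
Proof.
have c11 := chart_atP (1%g : G).
have df : differentiable (chart_mul c1 c1 c1) (chart c1 1%g, chart c1 1%g).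
  by apply: chart_mul_diff; rewrite ?mulg1.
apply: (diff_local_mul df); apply: filterS (chart_img_near c11) => x /chart_invK[_ xE].
  by rewrite /chart_mul /= chartK // mulg1.
by rewrite /chart_mul /= chartK // mul1g.
Qed.

End Group.

(** * Logarithmic derivatives of curves in a Lie group *)

(** The chain rule for a curve followed by a map of manifolds. *)
Lemma mder_diff_in (R : realType) (n k : nat) (M : manifoldType R n)
    (N : manifoldType R k) (J : finType) (U : J -> R -> R)
    (c : atlas M) (d : atlas N) (F : M -> N) (gam : R -> M) t v :
  lip_at U t -> {for t, continuous gam} ->
  has_mder U (chart c \o gam) t v -> diff_in c d F (gam t) ->
  has_mder U (chart d \o (F \o gam)) t (fun j => D_in c d F (gam t) (v j)).
Proof.
move=> lt cg dg [cp dp cF dF].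
apply: has_mder_near (has_mder_comp lt dg dF).
have : \forall s \near t, chart_dom c (gam s) by exact: cg _ (chart_dom_near cp).
by apply: filterS => s /= cs; rewrite chartK.
Qed.

Section GroupCurves.
Variables (R : realType) (n : nat) (G : lieGroupType R n).
Variables (J : finType) (U : J -> R -> R).
Implicit Types (a p q : G) (b c d : atlas G).

Local Notation c1 := (chart_at (1%g : G)).

(** The right logarithmic derivative of a curve: the velocity at s = t of
gam s * (gam t)^-1, a curve through the identity, whatever the point gam t. It
only involves the chart at the identity. *)
Definition log_mder (gam : R -> G) (t : R) (v : J -> 'rV[R]_n) :=
  {for t, continuous gam} /\
  has_mder U (fun s => chart c1 (gam s * (gam t)^-1)%g) t v.

Lemma inv_mder1 (k : R -> G) t v : lip_at U t -> {for t, continuous k} ->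
  k t = 1%g -> has_mder U (fun s => chart c1 (k s)) t v ->
  has_mder U (fun s => chart c1 (k s)^-1%g) t (fun j => - v j).
Proof.
move=> lt ck k1 dk.
have c11 := chart_atP (1%g : G).
have di : diff_in c1 c1 (fun g : G => g^-1)%g 1%g.
  by apply: smooth_map_diff_in => //; [exact: invg_smooth | rewrite invg1].
have di' : diff_in c1 c1 (fun g : G => g^-1)%g (k t) by rewrite k1.
have -> : (fun j => - v j) = (fun j => D_in c1 c1 (fun g : G => g^-1)%g (k t) (v j)).
  apply/funext => j; rewrite k1; apply/esym.
  have dii : differentiable (chart c1 \o (fun g : G => g^-1)%g \o chart_inv c1)
      (chart c1 (1%g : G)) by case: di.
  have df : differentiable (chart_mul c1 c1 c1) (chart c1 1%g, chart c1 1%g).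
    by apply: chart_mul_diff; rewrite ?mulg1.
  have ndom : \forall x \near chart c1 1%g, chart_dom c1 ((chart_inv c1 x)^-1)%g.
    have := inv_cvg _ (chart_inv_cont c11); rewrite invg1 => H.
    exact: H _ (chart_dom_near c11).
  apply: (diff_local_inv df) dii _ _.
  - by apply: filterS (chart_img_near c11) => x /chart_invK[_ xE]; rewrite /chart_mul /= chartK // mulg1.
  - by apply: filterS (chart_img_near c11) => x /chart_invK[_ xE]; rewrite /chart_mul /= chartK // mul1g.
  - by rewrite /= chartK // invg1.
  - apply: filterS2 ndom (chart_img_near c11) => x /= xd /chart_invK[xc _].
    by rewrite /chart_mul /= chartK // mulgV.
exact: (mder_diff_in lt ck dk di').
Qed.

Lemma invmul_mder1 (k1 k2 : R -> G) t v w : lip_at U t ->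
  {for t, continuous k1} -> {for t, continuous k2} -> k1 t = 1%g -> k2 t = 1%g ->
  has_mder U (fun s => chart c1 (k1 s)) t v ->
  has_mder U (fun s => chart c1 (k2 s)) t w ->
  has_mder U (fun s => chart c1 ((k1 s)^-1 * k2 s)%g) t (fun j => w j - v j).
Proof.
move=> lt ck1 ck2 k11 k21 d1 d2.
have c11 := chart_atP (1%g : G).
have d1' := inv_mder1 lt ck1 k11 d1.
have dp := has_mder_pair d1' d2.
have df : differentiable (chart_mul c1 c1 c1) (chart c1 (k1 t)^-1%g, chart c1 (k2 t)).
  by apply: chart_mul_diff; rewrite ?k11 ?k21 ?invg1 ?mulg1.
have := has_mder_comp lt dp df.
rewrite k11 k21 invg1.
have -> : (fun j => 'd (chart_mul c1 c1 c1) (chart c1 1%g, chart c1 1%g) (- v j, w j)) =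
          (fun j => w j - v j).
  by apply/funext => j; rewrite chart_mul_diff1 addrC.
apply: has_mder_near.
have n2 : \forall s \near t, chart_dom c1 (k2 s).
  by apply: ck2; rewrite k21; exact: chart_dom_near.
have n1 : \forall s \near t, chart_dom c1 (k1 s)^-1%g.
  have := inv_cvg _ ck1; rewrite k11 invg1 => H; exact: H _ (chart_dom_near c11).
by apply: filterS2 n1 n2 => s s1 s2; rewrite /chart_mul /= !chartK.
Qed.

(** The increment of the quotient factors as the conjugate by (gam t)^-1 of the
product of the inverse increment of gam and the increment of eta. *)
Lemma log_mder_quot (gam eta : R -> G) t v w : lip_at U t ->
  log_mder gam t v -> log_mder eta t w ->
  log_mder (fun s => (gam s)^-1 * eta s)%g t (fun j => Ad (gam t)^-1%g (w j - v j)).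
Proof.
move=> lt [cg dg] [ce de]; split.
  exact: (mul_cvg _ (inv_cvg _ cg) ce).
pose k1 s := (gam s * (gam t)^-1)%g.
pose k2 s := (eta s * (eta t)^-1)%g.
have ck1 : {for t, continuous k1} by exact: (mul_cvg _ cg (cvg_cst _)).
have ck2 : {for t, continuous k2} by exact: (mul_cvg _ ce (cvg_cst _)).
have k1t : k1 t = 1%g by rewrite /k1 mulgV.
have k2t : k2 t = 1%g by rewrite /k2 mulgV.
have dk := invmul_mder1 lt ck1 ck2 k1t k2t dg de.
pose k s := ((k1 s)^-1 * k2 s)%g.
have ck : {for t, continuous k} by exact: (mul_cvg _ (inv_cvg _ ck1) ck2).
have kt : k t = 1%g by rewrite /k k1t k2t invg1 mulg1.
have cj : diff_in c1 c1 (fun g : G => (gam t)^-1 * g * (gam t)^-1^-1)%g (k t).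
  by rewrite kt; exact: conj_diff_in.
have := mder_diff_in lt ck dk cj.
rewrite kt -/(Ad _); apply: has_mder_near; near=> s => /=.
by congr (chart _ _); rewrite /k /k1 /k2 !invgM !invgK !mulgA mulVg mul1g.
Unshelve. all: by end_near. Qed.

Lemma log_mder_of_chart c (gam : R -> G) t v : lip_at U t ->
  {for t, continuous gam} -> chart_dom c (gam t) ->
  has_mder U (chart c \o gam) t v ->
  log_mder gam t (fun j => D_in c c1 (fun g : G => g * (gam t)^-1)%g (gam t) (v j)).
Proof.
move=> lt cg cd dg; split => //.
apply: (mder_diff_in lt cg dg); apply: right_diff_in => //.
by rewrite mulgV; exact: chart_atP.
Qed.

(** Right translation by gam t takes the logarithmic derivative back to the
velocity in a chart. *)
Lemma chart_of_log_mder c (gam : R -> G) t v : lip_at U t ->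
  log_mder gam t v -> chart_dom c (gam t) ->
  has_mder U (chart c \o gam) t (fun j => D_in c1 c (fun g : G => g * gam t)%g 1%g (v j)).
Proof.
move=> lt [cg dg] cd.
pose k s := (gam s * (gam t)^-1)%g.
have ck : {for t, continuous k} by exact: (mul_cvg _ cg (cvg_cst _)).
have kt : k t = 1%g by rewrite /k mulgV.
have := @mder_diff_in _ _ _ _ _ _ _ c1 c (fun g : G => g * gam t)%g k t v lt ck dg.
rewrite kt => H; apply: has_mder_near (H _); last first.
  by apply: right_diff_in; [exact: chart_atP | rewrite mul1g].
by near=> s; rewrite /= /k mulgVK.
Unshelve. all: by end_near. Qed.

End GroupCurves.

Section Trivialize.
Variables (R : realType) (n : nat) (G : lieGroupType R n).
Implicit Types (a p q : G) (b c d : atlas G).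

Local Notation c1 := (chart_at (1%g : G)).

Lemma diff_in_id c d p : chart_dom c p -> chart_dom d p ->
  diff_in c d (fun g : G => g) p.
Proof.
move=> cp dp; have [sm _] := @transition_smooth _ _ G c d 1%N.
have := sm (chart c p) (ex_intro2 _ _ p (conj cp dp) erefl).
by move=> df; split; [exact: cp|exact: dp|exact: cvg_id|exact: df].
Qed.

Lemma coords_inE c p v : chart_dom c p ->
  coords_in c p v = D_in (chart_at p) c (fun g : G => g) p v.
Proof. by move=> cp; rewrite -D_inE //; exact: (diff_in_id (chart_atP p) cp). Qed.

(** Right trivialization of the tangent bundle. *)
Definition rtriv p (v : 'rV[R]_n) : 'rV[R]_n :=
  D_in (chart_at p) c1 (fun g : G => g * p^-1)%g p v.

Lemma right_diff_inV c p : chart_dom c p -> diff_in c c1 (fun g : G => g * p^-1)%g p.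
Proof. by move=> cp; apply: right_diff_in => //; rewrite mulgV; exact: chart_atP. Qed.

Lemma chart_rtriv c p v : chart_dom c p ->
  D_in c1 c (fun g : G => g * p)%g 1%g (rtriv p v) = coords_in c p v.
Proof.
move=> cp; rewrite coords_inE //.
have rV := right_diff_inV (chart_atP p).
have r : diff_in c1 c (fun g : G => g * p)%g ((fun g : G => g * p^-1)%g p).
  rewrite /= mulgV; apply: right_diff_in; first exact: chart_atP.
  by rewrite mul1g.
have [_ E] := diff_in_comp rV r.
have FE : (fun g : G => g * p)%g \o (fun g : G => g * p^-1)%g = (fun g => g).
  by apply/funext => g /=; rewrite mulgVK.
by have := E v; rewrite mulgV FE => ->.
Qed.

Lemma right_invariant_rtriv (Z : vector_field G) p :
  right_invariant Z -> rtriv p (Z p) = Z 1%g.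
Proof.
move=> /(_ p^-1%g p); rewrite /tangent_map mulgV => <-.
by rewrite /rtriv D_inE //; exact: right_diff_inV (chart_atP p).
Qed.

End Trivialize.

Section Flows.
Variables (R : realType) (n : nat) (G : lieGroupType R n).

Definition time1 : 'I_1 -> R -> R := fun=> id.

Lemma lip_time1 t : lip_at time1 t.
Proof.
exists 1 => //; near=> s => j; rewrite mul1r //.
Unshelve. all: by end_near. Qed.

Lemma time1_approx t (j : 'I_1) (e : R) : 0 < e ->
  \forall s \near t, `|time1 j s - time1 j t - (s - t) * 1| <= e * `|s - t|.
Proof.
move=> e0; near=> s; rewrite /time1 mulr1 subrr normr0 mulr_ge0 // ltW //.
Unshelve. all: by end_near. Qed.

Lemma time1_unique (V : normedModType R) (x : R -> V) t v w :
  has_mder time1 x t v -> has_mder time1 x t w -> v ord0 = w ord0.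
Proof.
move=> dv dw; have := has_mder_unique (time1_approx t) dv dw.
by rewrite !big_ord1 !scale1r.
Qed.

Definition right_field (X : vector_field G) (g : G) : 'rV[R]_n := rtriv g (X g).

Lemma flow_log_mder (X : vector_field G) phi g t : is_flow X phi ->
  log_mder time1 (phi^~ g) t (fun=> right_field X (phi t g)).
Proof.
move=> /(_ g)[_ /(_ t)[ct dt]].
apply: (log_mder_of_chart (v := fun=> X (phi t g)) (lip_time1 t) ct (chart_atP _)).
move=> e e0; have := is_derive_approx dt e0.
by apply: filterS => s; rewrite big_ord1.
Qed.

(** Differentiate phi_t(h) = phi_t(g)^-1 phi_t(gh) at t = 0 with the quotient
rule. *)
Lemma linear_field_cocycle (X : vector_field G) g h : linear_field X ->
  right_field X h = Ad g^-1%g (right_field X (g * h)%g - right_field X g).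
Proof.
move=> [phi [Xphi phiD phiA]].
have phi0 p : phi 0 p = p by case: (Xphi p).
have phiM t p q : phi t (p * q)%g = (phi t p * phi t q)%g.
  by have [[_ fM] _] := phiA t; exact: fM.
have := log_mder_quot (lip_time1 0) (flow_log_mder g 0 Xphi)
  (flow_log_mder (g * h)%g 0 Xphi).
have -> : (fun s => (phi s g)^-1 * phi s (g * h))%g = phi^~ h.
  by apply/funext => s; rewrite phiM mulKg.
rewrite !phi0 => -[_ d1].
have [_ d2] := flow_log_mder h 0 Xphi.
by have := time1_unique d2 d1; rewrite phi0.
Qed.

Lemma linear_field1 (X : vector_field G) : linear_field X -> right_field X 1%g = 0.
Proof.
move=> /(linear_field_cocycle 1%g 1%g) ->.
by rewrite mulg1 subrr /Ad /D_in linear0.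
Qed.

End Flows.

Section Homs.
Variables (R : realType) (n k : nat) (G : lieGroupType R n) (H : lieGroupType R k).
Variables (F : G -> H) (F_hom : lie_hom F).

Local Notation c1 := (chart_at (1%g : G)).
Local Notation d1 := (chart_at (1%g : H)).

Lemma lie_hom1 : F 1%g = 1%g.
Proof. by apply: (@mulgI H (F 1%g)); rewrite -F_hom.2 !mulg1. Qed.

Lemma lie_homV g : F g^-1%g = (F g)^-1%g.
Proof. by apply: (@mulgI H (F g)); rewrite -F_hom.2 !mulgV lie_hom1. Qed.

Definition lie_diff : 'rV[R]_n -> 'rV[R]_k := D_in c1 d1 F 1%g.

Lemma lie_diff_in : diff_in c1 d1 F 1%g.
Proof.
apply: smooth_map_diff_in; first exact: F_hom.1; first exact: chart_atP.
by rewrite lie_hom1; exact: chart_atP.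
Qed.

Lemma lie_diffE v : tangent_map F 1%g v = lie_diff v.
Proof. by rewrite /tangent_map lie_hom1 D_inE //; exact: lie_diff_in. Qed.

Lemma lie_diffB v w : lie_diff (v - w) = lie_diff v - lie_diff w.
Proof. by rewrite /lie_diff /D_in linearB. Qed.

Lemma log_mder_hom (J : finType) (U : J -> R -> R) gam t v :
  lip_at U t -> log_mder U gam t v ->
  log_mder U (F \o gam) t (fun j => lie_diff (v j)).
Proof.
move=> lt [cg dg]; split.
  have cF := F_hom.1.1 (gam t); exact: (continuous_comp cg cF).
pose kk s := (gam s * (gam t)^-1)%g.
have ck : {for t, continuous kk} by exact: (mul_cvg _ cg (cvg_cst _)).
have kt : kk t = 1%g by rewrite /kk mulgV.
have := mder_diff_in (F := F) (d := d1) lt ck dg.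
rewrite kt => /(_ lie_diff_in); apply: has_mder_near; near=> s.
by rewrite /= /kk F_hom.2 lie_homV.
Unshelve. all: by end_near. Qed.

(** Both sides are the differential at the identity of a * _ * a^-1 followed by
F, as F maps conjugation by a to conjugation by F a. *)
Lemma lie_diff_Ad a v : lie_diff (Ad a v) = Ad (F a) (lie_diff v).
Proof.
have ca := conj_diff_in a.
have ea : (a * 1 * a^-1 = 1)%g by rewrite mulg1 mulgV.
have Fa : diff_in c1 d1 F ((fun g : G => a * g * a^-1)%g 1%g).
  by rewrite /= ea; exact: lie_diff_in.
have [_ E1] := diff_in_comp ca Fa.
have cb : diff_in d1 d1 (fun g : H => F a * g * (F a)^-1)%g (F 1%g).
  by rewrite lie_hom1; exact: conj_diff_in.
have [_ E2] := diff_in_comp lie_diff_in cb.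
have FE : F \o (fun g : G => a * g * a^-1)%g = (fun g : H => F a * g * (F a)^-1)%g \o F.
  by apply/funext => g /=; rewrite !F_hom.2 lie_homV.
have := E1 v; rewrite FE E2 ea lie_hom1 => H1.
by rewrite /lie_diff /Ad H1.
Qed.

End Homs.

(** * Linear fields near the identity *)

Lemma rV_coord_le (R : realType) (n : nat) (x : 'rV[R]_n) i : `|x ord0 i| <= `|x|.
Proof.
rewrite [leRHS]/Num.norm /= mx_normrE.
exact: (le_bigmax _ (fun ij : 'I_1 * 'I_n => `|x ij.1 ij.2|) (ord0, i)).
Qed.

Lemma rV_norm_le (R : realType) (n : nat) (x : 'rV[R]_n) (c : R) :
  0 <= c -> (forall i, `|x ord0 i| <= c) -> `|x| <= c.
Proof.
move=> c0 xc; rewrite [leLHS]/Num.norm /= mx_normrE; apply/bigmax_leP; split => //.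
by move=> [i j] _ /=; rewrite (ord1 i); exact: xc.
Qed.

(** A closed set that contains a curve before time t contains it at time t. *)
Lemma left_closed (R : realType) (T : topologicalType) (A : set T) (gam : R -> T) (t : R) :
  closed A -> {for t, continuous gam} -> 0 < t ->
  (forall s, 0 <= s < t -> A (gam s)) -> A (gam t).
Proof.
move=> clA ct t0 As; apply: clA => B /ct.
move=> /(@nbhs_ballP R _ t)[d /= d0 Bd].
pose e := Num.min (d / 2) t.
have e0 : 0 < e by rewrite lt_min; apply/andP; split; lra.
have ed : e <= d / 2 by rewrite ge_min lexx.
have et : e <= t by rewrite ge_min lexx orbT.
exists (gam (t - e)); split.
  by apply: As; apply/andP; split; lra.
apply: Bd; rewrite /ball /= opprB addrC subrK gtr0_norm //; lra.
Qed.

Lemma near_right (R : realType) (t : R) (P : R -> Prop) : (\forall s \near t, P s) ->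
  exists2 d, 0 < d & forall s, t < s < t + d -> P s.
Proof.
move=> /(@nbhs_ballP R _ t)[d /= d0 Pd]; exists d => // s /andP[ts sd].
by apply: Pd; rewrite /ball /= distrC gtr0_norm; lra.
Qed.

Section NearIdentity.
Variables (R : realType) (n : nat) (G : lieGroupType R n).
Variables (J : finType) (X : J -> vector_field G).
Hypothesis Xlin : forall j, linear_field (X j).

Local Notation c1 := (chart_at (1%g : G)).
Local Notation o := (chart c1 (1%g : G)).
Local Notation N j := (field_in c1 (X j)).

Definition dist1 (g : G) : R := `|chart c1 g - o|.

Lemma field_in_chart j p : chart_dom c1 p ->
  N j (chart c1 p) = D_in c1 c1 (fun g : G => g * p)%g 1%g (right_field (X j) p).
Proof. by move=> cp; rewrite /field_in chartK // chart_rtriv. Qed.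

Lemma field_in0 j : N j o = 0.
Proof.
rewrite field_in_chart; last exact: chart_atP.
by rewrite linear_field1 // /D_in linear0.
Qed.

Lemma field_in_diff j : differentiable (N j) o.
Proof.
have [sm _] := vf_smooth (X j) c1 1%N.
by apply: sm; exists 1%g; [exact: chart_atP|].
Qed.

(** The linear part of a linear field at its zero, the identity. *)
Definition Dfield j : 'rV[R]_n -> 'rV[R]_n := 'd (N j) o.

Lemma field_in_approx j (e : R) : 0 < e ->
  \forall x \near o, `|N j x - Dfield j (x - o)| <= e * `|x - o|.
Proof.
move=> e0; have := diff_approx (field_in_diff j) e0.
by apply: filterS => x; rewrite field_in0 subr0.
Qed.

Lemma Dfield_bound : exists2 A, 0 < A & forall j v, `|Dfield j v| <= A * `|v|.
Proof.
have H j : exists A, 0 < A /\ forall v, `|Dfield j v| <= A * `|v|.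
  by have [A A0 HA] := diff_bound (field_in_diff j); exists A.
pose A := fun j => projT1 (cid (H j)).
have HA j : 0 < A j /\ forall v, `|Dfield j v| <= A j * `|v| by rewrite /A; case: cid.
exists (1 + \sum_j A j).
  by rewrite ltr_pwDl // sumr_ge0 // => j _; rewrite ltW // (HA j).1.
move=> j v; apply: (le_trans ((HA j).2 v)); rewrite ler_wpM2r //.
rewrite (bigD1 j) //= addrCA lerDl addr_ge0 // sumr_ge0 // => i _.
by rewrite ltW // (HA i).1.
Qed.

Lemma near_chart (P : 'rV[R]_n -> Prop) : (\forall x \near o, P x) ->
  exists2 r, 0 < r & forall x, `|x - o| <= r -> P x.
Proof.
move=> /(@nbhs_ballP R _ o)[d /= d0 Pd]; exists (d / 2); first by rewrite divr_gt0.
move=> x xd; apply: Pd; rewrite -ball_normE /= distrC.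
by apply: (le_lt_trans xd); lra.
Qed.

(** A closed ball of the chart is compact, hence closed in the Hausdorff space G:
a curve cannot leave the chart as long as it remains in the ball. *)
Lemma closed_chart_ball r : (forall x, `|x - o| <= r -> (chart c1 @` chart_dom c1) x) ->
  closed [set g : G | chart_dom c1 g /\ dist1 g <= r].
Proof.
move=> rim.
have -> : [set g : G | chart_dom c1 g /\ dist1 g <= r] =
   chart_inv c1 @` [set x | `|x - o| <= r].
  apply/seteqP; split => [g [cg gr]|g [x xr <-]] /=.
    by exists (chart c1 g); [exact: gr|rewrite chartK].
  by have [cx xE] := chart_invK (rim x xr); split=> //; rewrite /dist1 xE.
apply: compact_closed; first exact: manifold_hausdorff.
apply: continuous_compact.
  apply: continuous_in_subspaceT => x; rewrite inE => /= xr.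
  by apply: chart_inv_continuous; exact: rim.
apply: bounded_closed_compact.
  exists (r + `|o|); split; first by rewrite num_real.
  move=> y yr x /= xr; rewrite -[x](subrK o).
  by apply: (le_trans (ler_normD _ _)); apply: ltW; apply: le_lt_trans yr; rewrite lerD2r.
have -> : [set x | `|x - o| <= r] = closed_ball_ Num.norm o r.
  by apply/seteqP; split => x /=; rewrite distrC.
exact: closed_closed_ball_.
Qed.

(** A linear field vanishes at the identity and is differentiable there, so it is
bounded by a multiple of the distance to the identity. *)
Lemma near_identity : exists r A, [/\ 0 < r, 0 < A,
   forall x, `|x - o| <= r -> (chart c1 @` chart_dom c1) x,
   closed [set g : G | chart_dom c1 g /\ dist1 g <= r] &
   forall j x, `|x - o| <= r -> `|N j x| <= A * `|x - o| ].
Proof.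
have [A A0 DA] := Dfield_bound.
have Nn : \forall x \near o, forall j, `|N j x - Dfield j (x - o)| <= 1 * `|x - o|.
  exact: filter_forall (fun j => field_in_approx j ltr01).
have [r r0 Hr] := near_chart (filterI (chart_img_near (chart_atP (1%g : G))) Nn).
exists r, (A + 1); split => //; first by lra.
- by move=> x /Hr[].
- by apply: closed_chart_ball => x /Hr[].
move=> j x /Hr[_ /(_ j) Hx].
rewrite -[N j x](subrK (Dfield j (x - o))); apply: (le_trans (ler_normD _ _)).
by rewrite addrC mulrDl lerD.
Qed.

End NearIdentity.

(** * Stability of linear systems near the identity *)

Section Reparam.
Variables (R : realType) (J : finType) (U : J -> R -> R) (a sg : R).
Hypothesis sg1 : `|sg| = 1.

(** Starting at time a and running in the direction sg. Both directions are needed: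
the backward estimate bounds the flow from below. *)
Definition reparam (j : J) (s : R) := U j (a + sg * s).

Lemma reparam_cont (T : topologicalType) (gam : R -> T) t :
  {for a + sg * t, continuous gam} -> {for t, continuous (fun s => gam (a + sg * s))}.
Proof.
move=> cg; have h : (fun s : R => a + sg * s) @ t --> a + sg * t.
  by apply: cvgD; [exact: cvg_cst | apply: cvgM; [exact: cvg_cst|exact: cvg_id]].
exact: (cvg_comp _ _ h cg).
Qed.

Lemma has_mder_reparam (V : normedModType R) (x : R -> V) t v :
  has_mder U x (a + sg * t) v ->
  has_mder reparam (fun s => x (a + sg * s)) t v.
Proof.
move=> dx e e0.
have h : (fun s : R => a + sg * s) @ t --> a + sg * t.
  by apply: cvgD; [exact: cvg_cst | apply: cvgM; [exact: cvg_cst|exact: cvg_id]].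
have H : \forall s \near t, `|x (a + sg * s) - x (a + sg * t) -
    \sum_j (U j (a + sg * s) - U j (a + sg * t)) *: v j| <=
    e * `|a + sg * s - (a + sg * t)|.
  exact: h _ (dx e e0).
apply: filterS H => s.
have -> : a + sg * s - (a + sg * t) = sg * (s - t) by ring.
by rewrite normrM sg1 mul1r.
Qed.

Lemma log_mder_reparam n (G : lieGroupType R n) (gam : R -> G) t v :
  log_mder U gam (a + sg * t) v ->
  log_mder reparam (fun s => gam (a + sg * s)) t v.
Proof.
move=> [cg dg]; split; first exact: reparam_cont.
exact: (has_mder_reparam dg).
Qed.

End Reparam.

Definition lip_on (R : realType) (J : finType) (U : J -> R -> R) (T K : R) :=
  forall j s t, `|s| <= T -> `|t| <= T -> `|U j s - U j t| <= K * `|s - t|.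

Lemma lip_on_near (R : realType) (J : finType) (U : J -> R -> R) (T K : R) t :
  lip_on U (T + 1) K -> `|t| <= T ->
  \forall s \near t, forall j, `|U j s - U j t| <= K * `|s - t|.
Proof.
move=> UK tT.
have n1 : \forall s \near t, `|t - s| <= 1.
  by apply/(@nbhs_ballP R _ t); exists 1 => //= s; exact: ltW.
apply: filterS n1 => s s1 j; apply: UK; last by rewrite (le_trans tT) // lerDl.
rewrite -[s](subrK t) addrC; apply: (le_trans (ler_normD _ _)).
by apply: lerD; rewrite // distrC.
Qed.

Lemma reparam_lip_on (R : realType) (J : finType) (U : J -> R -> R) (a sg T K : R) :
  `|sg| = 1 -> `|a| <= T -> lip_on U (T + T + 1) K ->
  lip_on (reparam U a sg) (T + 1) K.
Proof.
move=> sg1 aT UK j s t sT tT; rewrite /reparam.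
have b u : `|u| <= T + 1 -> `|a + sg * u| <= T + T + 1.
  move=> uT; apply: (le_trans (ler_normD _ _)).
  by rewrite normrM sg1 mul1r -addrA lerD.
apply: (le_trans (UK j _ _ (b s sT) (b t tT))).
have -> : a + sg * s - (a + sg * t) = sg * (s - t) by ring.
by rewrite normrM sg1 mul1r.
Qed.

Section Stability.
Variables (R : realType) (n : nat) (G : lieGroupType R n).
Variables (J : finType) (X : J -> vector_field G).
Hypothesis Xlin : forall j, linear_field (X j).

Local Notation c1 := (chart_at (1%g : G)).
Local Notation o := (chart c1 (1%g : G)).
Local Notation N j := (field_in c1 (X j)).

Definition solves (U : J -> R -> R) (chi : R -> G) :=
  forall t, log_mder U chi t (fun j => right_field (X j) (chi t)).

Lemma solves_reparam U a sg chi : `|sg| = 1 -> solves U chi ->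
  solves (reparam U a sg) (fun s => chi (a + sg * s)).
Proof. by move=> sg1 sU t; apply: (log_mder_reparam sg1 (sU _)). Qed.

Lemma solves_chart U chi t : lip_at U t -> solves U chi -> chart_dom c1 (chi t) ->
  has_mder U (fun s => chart c1 (chi s) - o) t (fun j => N j (chart c1 (chi t))).
Proof.
move=> lt sU ct; have := chart_of_log_mder lt (sU t) ct.
have -> : (fun j => D_in c1 c1 (fun g : G => g * chi t)%g 1%g
     (right_field (X j) (chi t))) = fun j => N j (chart c1 (chi t)).
  by apply/funext => j; rewrite field_in_chart.
move=> dx e e0; apply: filterS (dx e e0) => s /=.
by rewrite opprB addrA subrK.
Qed.

(** The identity is an equilibrium, so by Gronwall the distance to it grows at most
exponentially as long as the curve stays in the ball of radius r, and the bound
keeps it there up to time T. The constants r and A depend on the fields only. *)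
Lemma linear_system_stability : exists r A, [/\ 0 < r, 0 < A,
  forall x, `|x - o| <= r -> (chart c1 @` chart_dom c1) x &
  forall U K T chi B, 0 < K -> 0 <= T -> lip_on U (T + 1) K -> solves U chi ->
    chart_dom c1 (chi 0) -> dist1 (chi 0) <= B -> 0 < B ->
    B * expR ((K * (#|J|%:R * A) + 2) * T) <= r ->
    forall t, 0 <= t <= T -> chart_dom c1 (chi t) /\
      dist1 (chi t) <= B * expR ((K * (#|J|%:R * A) + 2) * t)].
Proof.
have [r [A [r0 A0 rim clr NA]]] := near_identity Xlin.
exists r, A; split => // U K T chi B K0 T0 UK sU c0 d0 B0 Br.
set C := K * (#|J|%:R * A).
have C0 : 0 <= C by rewrite mulr_ge0 ?(ltW K0) // mulr_ge0 // ltW.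
have bT t : 0 <= t <= T -> B * expR ((C + 2) * t) <= r.
  move=> /andP[t0 tT]; apply: le_trans Br; rewrite ler_wpM2l ?(ltW B0) //.
  by rewrite ler_expR ler_wpM2l // addr_ge0.
have lipT t : 0 <= t <= T -> \forall s \near t, forall j, `|U j s - U j t| <= K * `|s - t|.
  by move=> /andP[t0 tT]; apply: (lip_on_near UK); rewrite ger0_norm.
have latT t : 0 <= t <= T -> lip_at U t by move=> tT; exists K => //; exact: lipT.
have chic t : {for t, continuous chi} := (sU t).1.
apply: (@gronwall R T C B (fun t => dist1 (chi t)) (fun t => chart_dom c1 (chi t))) => //.
- move=> t /andP[t0 tT] ct ft e e0.
  have tT' : 0 <= t <= T by rewrite t0 ltW.
  have dx := solves_chart (latT t tT') sU ct.
  have dn := has_mder_norm_le (ltW K0) (lipT t tT') dx e0.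
  have cn : \forall s \near t, chart_dom c1 (chi s) by exact: chic _ (chart_dom_near ct).
  have [d dd0 Hd] := near_right (filterI cn dn).
  exists d => // s sd; have [cs fs] := Hd s sd; split=> //.
  apply: (le_trans fs); rewrite -/(dist1 _) lerD2l.
  have st : 0 < s - t by lra.
  rewrite gtr0_norm // ler_pM2l // lerD //.
  apply: (@le_trans _ _ (C * `|dist1 (chi t)|)); last by rewrite lerDl ltW.
  rewrite /C -mulrA ler_pM2l // ger0_norm //.
  apply: (@le_trans _ _ (\sum_(j : J) A * dist1 (chi t))).
    by apply: ler_sum => j _; apply: NA; apply: (le_trans ft); exact: bT.
  by rewrite sumr_const -[leLHS]mulr_natl mulrA.
  exact: normr_ge0.
- by move=> t _; exact: normr_ge0.
move=> t t0 H; have tT : 0 <= t <= T by case/andP: t0 => t0 ->; rewrite ltW.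
have t0' : 0 < t by case/andP: t0.
pose b := B * expR ((C + 2) * t).
have br : b <= r by exact: bT.
have clb : closed [set g : G | chart_dom c1 g /\ dist1 g <= b].
  by apply: closed_chart_ball => x xb; apply: rim; exact: le_trans br.
apply: (left_closed clb (chic t) t0') => s sb; have [cs fs] := H s sb; split => //.
apply: (le_trans fs); rewrite ler_wpM2l ?(ltW B0) // ler_expR ler_wpM2l ?addr_ge0 //.
by case/andP: sb => _ /ltW.
Qed.

End Stability.

(** The bound is only asked for small e, the range in which the estimates that
produce it hold. *)
Lemma le0_small (R : realType) (x c e0 : R) : 0 < e0 -> 0 <= c ->
  (forall e, 0 < e <= e0 -> x <= c * e) -> x <= 0.
Proof.
move=> e00 c0 H; apply/ler_addgt0Pr => eta eta0; rewrite add0r.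
pose e := Num.min e0 (eta / (c + 1)).
have c10 : 0 < c + 1 by lra.
have e_gt0 : 0 < e by rewrite lt_min e00 divr_gt0.
have ee0 : e <= e0 by rewrite ge_min lexx.
have eeta : e <= eta / (c + 1) by rewrite ge_min lexx orbT.
apply: (le_trans (H e _)); first by rewrite e_gt0.
apply: (@le_trans _ _ ((c + 1) * e)); first by rewrite ler_wpM2r ?(ltW e_gt0) // lerDl.
by rewrite mulrC -ler_pdivlMr.
Qed.

Lemma subrACA (V : zmodType) (a b c d : V) : (a - b) - (c - d) = (a - c) - (b - d).
Proof. by rewrite opprD addrACA -opprD. Qed.

Section Superposition.
Variables (R : realType) (V : normedModType R) (J : finType) (U : J -> R -> R).

Lemma has_mderB (x y : R -> V) t v w :
  has_mder U x t v -> has_mder U y t w ->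
  has_mder U (fun s => x s - y s) t (fun j => v j - w j).
Proof.
move=> dx dy e e0; have e2 : 0 < e / 2 by rewrite divr_gt0.
apply: filterS2 (dx _ e2) (dy _ e2) => s xs ys.
have -> : x s - y s - (x t - y t) - \sum_j (U j s - U j t) *: (v j - w j) =
  (x s - x t - \sum_j (U j s - U j t) *: v j) -
  (y s - y t - \sum_j (U j s - U j t) *: w j).
  under eq_bigr do rewrite scalerBr.
  by rewrite sumrB (subrACA (x s)) (subrACA (x s - x t)).
by apply: (le_trans (ler_normB _ _)); rewrite [e]splitr mulrDl lerD.
Qed.

(** If curves solve the linear equation given by D up to an error delta, so does a
linear combination of them, up to a multiple of delta; Gronwall bounds its
distance to a curve with the same initial value. *)
Lemma superposition (n : nat) (K T AD delta : R) (D : J -> {linear V -> V})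
   (x : R -> V) (v : R -> J -> V) (xi : 'I_n -> R -> V) (vi : 'I_n -> R -> J -> V)
   (a : 'I_n -> R) :
  0 <= T -> 0 < K -> 0 <= AD -> 0 < delta -> lip_on U (T + 1) K ->
  (forall j u, `|D j u| <= AD * `|u|) -> (forall i, `|a i| <= 1) ->
  (forall t, 0 <= t <= T -> has_mder U x t (v t) /\
     forall j, `|v t j - D j (x t)| <= delta) ->
  (forall i t, 0 <= t <= T -> has_mder U (xi i) t (vi i t) /\
     forall j, `|vi i t j - D j (xi i t)| <= delta) ->
  x 0 = \sum_i a i *: xi i 0 ->
  `|x T - \sum_i a i *: xi i T| <=
    (K * (#|J|%:R * (1 + n%:R)) + 1) * delta * expR ((K * (#|J|%:R * AD) + 2) * T).
Proof.
move=> T0 K0 AD0 delta0 UK DA a1 dx dxi x0.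
set y := fun t => x t - \sum_i a i *: xi i t.
pose w t j := v t j - \sum_i a i *: vi i t j.
have dy t : 0 <= t <= T -> has_mder U y t (w t).
  move=> tT; apply: has_mderB; first exact: (dx t tT).1.
  by apply: has_mder_lin => i; exact: (dxi i t tT).1.
have wle t j : 0 <= t <= T -> `|w t j| <= AD * `|y t| + (1 + n%:R) * delta.
  move=> tT.
  have -> : w t j = D j (y t) + ((v t j - D j (x t)) -
       \sum_i a i *: (vi i t j - D j (xi i t))).
    have DS : D j (\sum_i a i *: xi i t) = \sum_i a i *: D j (xi i t).
      by rewrite linear_sum; apply: eq_bigr => i _; rewrite linearZ.
    have SB : \sum_i a i *: (vi i t j - D j (xi i t)) =
        \sum_i a i *: vi i t j - \sum_i a i *: D j (xi i t).
      by rewrite -sumrB; apply: eq_bigr => i _; rewrite scalerBr.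
    by rewrite /w /y linearB DS SB (subrACA (v t j)) [RHS]addrC subrK.
  apply: (le_trans (ler_normD _ _)); rewrite lerD //.
  apply: (le_trans (ler_normB _ _)); rewrite mulrDl mul1r lerD //.
    exact: (dx t tT).2.
  apply: (le_trans (ler_norm_sum _ _ _)).
  apply: (@le_trans _ _ (\sum_(i < n) delta)).
    apply: ler_sum => i _; rewrite normrZ -[leRHS]mul1r ler_pM //.
    exact: (dxi i t tT).2.
  by rewrite sumr_const card_ord -[leLHS]mulr_natl.
have lipT t : 0 <= t <= T -> \forall s \near t, forall j, `|U j s - U j t| <= K * `|s - t|.
  by move=> /andP[t0 tT]; apply: (lip_on_near UK); rewrite ger0_norm.
have B1 : 1 <= K * (#|J|%:R * (1 + n%:R)) + 1.
  by rewrite lerDr !mulr_ge0 ?(ltW K0) // addr_ge0.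
have C0 : 0 <= K * (#|J|%:R * AD) by rewrite !mulr_ge0 ?(ltW K0).
have B0 : 0 < (K * (#|J|%:R * (1 + n%:R)) + 1) * delta.
  by rewrite mulr_gt0 //; apply: lt_le_trans B1.
have gr := @gronwall R T _ _ (fun t => `|y t|) (fun=> True) T0 C0 B0.
suff yb t : 0 <= t <= T -> True /\ `|y t| <=
   (K * (#|J|%:R * (1 + n%:R)) + 1) * delta * expR ((K * (#|J|%:R * AD) + 2) * t).
  by have [] := yb T; rewrite ?T0 ?lexx.
move: t; apply: gr.
- by [].
- by rewrite /y x0 subrr normr0 ltW.
- move=> t /andP[t0 tT] _ _ e e0.
  have tT' : 0 <= t <= T by rewrite t0 ltW.
  have [d dd0 Hd] := near_right (has_mder_norm_le (ltW K0) (lipT t tT') (dy t tT') e0).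
  exists d => // s sd; split => //; apply: (le_trans (Hd s sd)); rewrite lerD2l.
  have st : 0 < s - t by lra.
  rewrite gtr0_norm // ler_pM2l // lerD2r normr_id.
  apply: (@le_trans _ _ (K * \sum_(j : J) (AD * `|y t| + (1 + n%:R) * delta))).
    by rewrite ler_pM2l //; apply: ler_sum => j _; exact: wle.
  rewrite sumr_const -[X in K * X <= _]mulr_natl.
  have -> : K * (#|J|%:R * (AD * `|y t| + (1 + n%:R) * delta)) =
     K * (#|J|%:R * AD) * `|y t| + K * (#|J|%:R * (1 + n%:R)) * delta by ring.
  by rewrite lerD2l mulrDl mul1r lerDl ltW.
- by move=> t _; exact: normr_ge0.
- move=> t t0 H; split=> //.
  have tT : 0 <= t <= T by case/andP: t0 => t0 ->; rewrite ltW.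
  have t0' : 0 < t by case/andP: t0.
  set b := _ * expR _.
  have clb : closed [set u : V | `|u| <= b].
    have -> : [set u : V | `|u| <= b] = closed_ball_ Num.norm 0 b.
      by apply/seteqP; split => u; rewrite /closed_ball_ /= sub0r normrN.
    exact: closed_closed_ball_.
  have lt : lip_at U t by exists K => //; exact: lipT.
  apply: (left_closed clb (has_mder_cont lt (dy t tT)) t0') => s sb.
  have [_ fs] := H s sb; apply: (le_trans fs).
  rewrite ler_wpM2l ?(ltW B0) // ler_expR ler_wpM2l ?addr_ge0 //.
  by case/andP: sb => _ /ltW.
Qed.

End Superposition.

(** * Uniqueness and linearization *)

Definition loc_lip (R : realType) (J : finType) (U : J -> R -> R) :=
  forall T, exists2 K, 0 < K & lip_on U T K.

Lemma loc_lip_at (R : realType) (J : finType) (U : J -> R -> R) t :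
  loc_lip U -> lip_at U t.
Proof.
move=> /(_ (`|t| + 1))[K K0 UK]; exists K => //.
exact: (lip_on_near UK).
Qed.

Lemma sign_split (R : realType) (t : R) : exists2 sg : R, `|sg| = 1 & t = sg * `|t|.
Proof.
have [t0|t0] := leP 0 t.
  by exists 1; [rewrite normr1|rewrite mul1r ger0_norm].
by exists (-1); [rewrite normrN1|rewrite mulN1r ltr0_norm // opprK].
Qed.

Section LinearSystem.
Variables (R : realType) (n : nat) (G : lieGroupType R n).
Variables (J : finType) (X : J -> vector_field G).
Hypothesis Xlin : forall j, linear_field (X j).

Local Notation c1 := (chart_at (1%g : G)).
Local Notation o := (chart c1 (1%g : G)).
Local Notation N j := (field_in c1 (X j)).

Lemma dist1_eq0 (g : G) : chart_dom c1 g -> dist1 g <= 0 -> g = 1%g.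
Proof.
move=> cg; rewrite normr_le0 subr_eq0 => /eqP E.
by rewrite -(chartK _ _ cg) E chartK //; exact: chart_atP.
Qed.

(** The stability estimate applies with arbitrarily small initial bound. *)
Lemma linear_system_unique U chi : loc_lip U -> solves X U chi -> chi 0 = 1%g ->
  forall t, chi t = 1%g.
Proof.
move=> Ul sU chi0 t.
have [r [A [r0 A0 _ stab]]] := linear_system_stability Xlin.
have [sg sg1 tE] := sign_split t.
have [K K0 UK] := Ul (`|t| + `|t| + 1).
have UK' : lip_on (reparam U 0 sg) (`|t| + 1) K.
  by apply: reparam_lip_on => //; rewrite normr0.
have sU' := solves_reparam 0 sg1 sU.
set Om := expR ((K * (#|J|%:R * A) + 2) * `|t|).
have Om0 : 0 < Om by exact: expR_gt0.
have main e : 0 < e <= r -> chart_dom c1 (chi t) /\ dist1 (chi t) <= e.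
  move=> /andP[e0 er].
  have H := stab _ K `|t| _ (e / Om) K0 (normr_ge0 t) UK' sU'.
  have := H _ _ _ _ `|t|.
  rewrite mulr0 addr0 chi0 /dist1 subrr normr0 -/Om divfK ?gt_eqF //.
  rewrite add0r -tE; apply => //.
  - exact: chart_atP.
  - by rewrite divr_ge0 ?ltW.
  - by rewrite divr_gt0.
  - by rewrite normr_ge0 lexx.
have ct : chart_dom c1 (chi t) by have [] := main r; rewrite ?r0 ?lexx.
apply: dist1_eq0 => //; apply: (@le0_small _ _ 1 r) => // e er.
by rewrite mul1r; exact: (main e er).2.
Qed.

Section Spanning.
Variables (W : normedModType R) (U : J -> R -> R) (T K : R) (S : G -> R -> G).
Variables (L : 'rV[R]_n -> W) (E : G -> W).
Hypotheses (T0 : 0 <= T) (K0 : 0 < K) (UK : lip_on U (T + T + 1) K).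
Hypotheses (S0 : forall g, S g 0 = g) (SU : forall g, solves X U (S g)).
Hypothesis Llin : forall (a : 'I_n -> R) v,
  L (\sum_i a i *: v i) = \sum_i a i *: L (v i).
Hypothesis EL : forall e : R, 0 < e -> exists2 rho : R, 0 < rho &
  forall p, chart_dom c1 p -> dist1 p <= rho ->
    `|E p - L (chart c1 p - o)| <= e * dist1 p.
Hypothesis ES : forall g, E (S g T) = 0.

(** The time-T map of a linear system covers all directions at the identity, to
first order. Start at s v in the chart, for small s. By [superposition] the end
point x_v is s (v M) up to a small multiple of s, where M has the rows x_(e_i) / s;
by stability run backward, it is at least a fixed multiple of s |v| away from the
identity. So M is invertible with inverse bounded independently of s. Since E
vanishes at the end points, L is small on the rows of M, hence everywhere. *)
Lemma linearized_span w : L w = 0.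
Proof.
have [r [A [r0 A0 rim stab]]] := linear_system_stability Xlin.
have [AD AD0 DA] := Dfield_bound X.
set Om := expR ((K * (#|J|%:R * A) + 2) * T).
have Om1 : 1 <= Om.
  rewrite /Om -expR0 ler_expR mulr_ge0 // addr_ge0 //.
  by rewrite !mulr_ge0 ?(ltW K0) // ltW.
have Om0 : 0 < Om by apply: lt_le_trans Om1.
pose c3 := Om * (K * (#|J|%:R * (1 + n%:R)) + 1) * expR ((K * (#|J|%:R * AD) + 2) * T).
have c30 : 0 < c3.
  rewrite /c3 mulr_gt0 ?expR_gt0 // mulr_gt0 // ltr_pwDr //.
  by rewrite !mulr_ge0 ?(ltW K0) // addr_ge0.
have UK1 : lip_on U (T + 1) K.
  by move=> j s t sT tT; apply: UK; [apply: (le_trans sT)|apply: (le_trans tT)];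
    rewrite -addrA lerDr.
have UKr : lip_on (reparam U T (-1)) (T + 1) K.
  by apply: reparam_lip_on => //; rewrite ?normrN1 ?ger0_norm.
(* the initial point s v, and the chart coordinates x of the trajectory from it *)
pose g s (v : 'rV[R]_n) := chart_inv c1 (o + s *: v).
pose x s v t := chart c1 (S (g s v) t) - o.
pose ei (i : 'I_n) : 'rV[R]_n := delta_mx ord0 i.
have ei1 i : `|ei i| <= 1.
  by apply: rV_norm_le => // k; rewrite mxE; case: (_ && _); rewrite ?normr1 ?normr0.
have gP s v : 0 < s -> s * Om <= r -> `|v| <= 1 ->
    [/\ chart_dom c1 (g s v), chart c1 (g s v) = o + s *: v & dist1 (g s v) <= s].
  move=> s0 sr v1.
  have sv : `|s *: v| <= s by rewrite normrZ gtr0_norm // -[leRHS]mulr1 ler_pM2l.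
  have im : (chart c1 @` chart_dom c1) (o + s *: v).
    apply: rim; rewrite addrC addKr; apply: (le_trans sv); apply: le_trans sr.
    by rewrite -[leLHS]mulr1 ler_pM2l.
  have [cg gE] := chart_invK im; split => //.
  by rewrite /dist1 /g gE addrC addKr.
have fwd s v : 0 < s -> s * Om <= r -> `|v| <= 1 -> forall t, 0 <= t <= T ->
    chart_dom c1 (S (g s v) t) /\ dist1 (S (g s v) t) <= s * Om.
  move=> s0 sr v1 t tT; have [cg gE dg] := gP s v s0 sr v1.
  have H := stab U K T (S (g s v)) s K0 T0 UK1 (SU _).
  have := H _ _ _ _ t tT; rewrite S0 => /(_ cg dg s0 sr)[ct dt]; split => //.
  apply: (le_trans dt); rewrite ler_pM2l // ler_expR.
  case/andP: tT => _ tT; rewrite ler_wpM2l // addr_ge0 //.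
  by rewrite !mulr_ge0 ?(ltW K0) // ltW.
have bwd s v B : 0 < s -> s * Om <= r -> `|v| <= 1 -> 0 < B -> B * Om <= r ->
    `|x s v T| <= B -> s * `|v| <= B * Om.
  move=> s0 sr v1 B0 Br xB; have [cg gE dg] := gP s v s0 sr v1.
  have [cT dT] := fwd s v s0 sr v1 T (ltac:(by rewrite T0 lexx)).
  have sU' := solves_reparam T (normrN1 R) (SU (g s v)).
  have H := stab _ K T _ B K0 T0 UKr sU'.
  have := H _ _ _ _ T; rewrite mulr0 addr0 mulN1r subrr S0.
  move=> /(_ cT xB B0 Br)[|_]; first by rewrite T0 lexx.
  by rewrite /dist1 gE addrC addKr normrZ gtr0_norm.
(* small enough for the superposition error to be half of the lower bound s / Om *)
pose e0 := 1 / (2 * Om * c3).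
have e00 : 0 < e0 by rewrite /e0 divr_gt0 // mulr_gt0 // mulr_gt0.
suff Lw : `|L w| <= 0 by apply/eqP; rewrite -normr_le0.
apply: (le0_small (c := n%:R * (2 * Om * `|w|) * Om) e00).
  by rewrite !mulr_ge0 ?(ltW Om0).
move=> e /andP[e_gt0 ee0].
have [rho rho0 Hrho] := EL e_gt0.
have Nn : \forall y \near o, forall j, `|N j y - Dfield X j (y - o)| <= e * `|y - o|.
  exact: filter_forall (fun j => field_in_approx Xlin j e_gt0).
have [rho' rho'0 Hrho'] := near_chart Nn.
pose m := Num.min r (Num.min rho rho').
have m0 : 0 < m by rewrite !lt_min r0 rho0 rho'0.
pose s := m / Om.
have s0 : 0 < s by rewrite divr_gt0.
have sOm : s * Om = m by rewrite /s divfK // gt_eqF.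
have sr : s * Om <= r by rewrite sOm ge_min lexx.
have srho : s * Om <= rho by rewrite sOm !ge_min lexx orbT.
have srho' : s * Om <= rho' by rewrite sOm !ge_min lexx !orbT.
have lipT t : 0 <= t <= T -> lip_at U t.
  by move=> /andP[t0 tT]; exists K => //; apply: (lip_on_near UK1); rewrite ger0_norm.
have xder v : `|v| <= 1 -> forall t, 0 <= t <= T ->
    has_mder U (x s v) t (fun j => N j (chart c1 (S (g s v) t))) /\
    forall j, `|N j (chart c1 (S (g s v) t)) - Dfield X j (x s v t)| <= e * (s * Om).
  move=> v1 t tT; have [ct dt] := fwd s v s0 sr v1 t tT.
  split; first exact: (solves_chart (lipT t tT) (SU (g s v)) ct).
  move=> j; apply: le_trans (Hrho' _ (le_trans dt srho') j) _.
  by rewrite ler_pM2l.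
have sup (v : 'rV[R]_n) : `|v| <= 1 ->
    `|x s v T - \sum_i v ord0 i *: x s (ei i) T| <= s * (e * c3).
  move=> v1.
  have esO : 0 < e * (s * Om) := mulr_gt0 e_gt0 (mulr_gt0 s0 Om0).
  have := @superposition _ _ J U n K T AD (e * (s * Om))
     (fun j => 'd (N j) o) (x s v) (fun t j => N j (chart c1 (S (g s v) t)))
     (fun i => x s (ei i)) (fun i t j => N j (chart c1 (S (g s (ei i)) t)))
     (fun i => v ord0 i) T0 K0 (ltW AD0) esO UK1 DA _ (xder v v1) (fun i => xder _ (ei1 i)).
  move=> H; apply: (le_trans (H _ _)).
  - by move=> i; exact: (le_trans (rV_coord_le _ _)).
  - have x00 u : `|u| <= 1 -> x s u 0 = s *: u.
      by move=> u1; have [_ gE _] := gP s u s0 sr u1; rewrite /x S0 gE addrC addKr.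
    rewrite x00 // [in LHS](row_sum_delta v) scaler_sumr; apply: eq_bigr => i _.
    by rewrite x00 // !scalerA mulrC.
  - by rewrite le_eqVlt; apply/orP; left; apply/eqP; rewrite /c3; ring.
(* the time-T map on the basis, rescaled *)
pose M := \matrix_(i < n) (s^-1 *: x s (ei i) T).
have vM (v : 'rV[R]_n) : s *: (v *m M) = \sum_i v ord0 i *: x s (ei i) T.
  rewrite mulmx_sum_row scaler_sumr; apply: eq_bigr => i _.
  by rewrite rowK !scalerA mulrAC mulfV ?mul1r ?gt_eqF.
have ec3 : e * c3 <= 1 / (2 * Om).
  apply: (@le_trans _ _ (e0 * c3)); first by rewrite ler_pM2r.
  by rewrite le_eqVlt; apply/orP; left; apply/eqP; rewrite /e0; field; rewrite !gt_eqF.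
have low1 (v : 'rV[R]_n) : `|v| = 1 -> 1 / (2 * Om) <= `|v *m M|.
  move=> v1; rewrite leNgt; apply/negP => vMlt.
  have v1' : `|v| <= 1 by rewrite v1.
  have xlt : `|x s v T| < s / Om.
    rewrite -[x s v T](subrK (\sum_i v ord0 i *: x s (ei i) T)).
    apply: (le_lt_trans (ler_normD _ _)).
    have -> : s / Om = s * (1 / (2 * Om)) + s * (1 / (2 * Om)).
      by field; rewrite gt_eqF.
    apply: ler_ltD; first by apply: (le_trans (sup v v1')); rewrite ler_pM2l.
    by rewrite -vM normrZ gtr0_norm // ltr_pM2l.
  pose B := Num.max `|x s v T| (s / (2 * Om)).
  have B0 : 0 < B by rewrite lt_max (divr_gt0 s0 (mulr_gt0 _ Om0)) ?orbT.
  have Blt : B * Om < s.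
    rewrite -ltr_pdivlMr // gt_max xlt /= ltr_pM2l // ltf_pV2 ?posrE ?mulr_gt0 //.
    by rewrite ltr_pMl // ltr1n.
  have xB : `|x s v T| <= B by rewrite le_max lexx.
  have Br : B * Om <= r.
    apply: (le_trans (ltW Blt)); apply: le_trans sr.
    by rewrite -[leLHS]mulr1 ler_pM2l.
  have := bwd s v B s0 sr v1' B0 Br xB.
  by rewrite v1 mulr1 leNgt Blt.
have low (v : 'rV[R]_n) : `|v| <= 2 * Om * `|v *m M|.
  have [->|v0] := eqVneq v 0; first by rewrite normr0 mulr_ge0 // mulr_ge0 // ltW.
  have nv : 0 < `|v| by rewrite normr_gt0.
  have := low1 (`|v|^-1 *: v).
  rewrite normrZ ger0_norm ?invr_ge0 // mulVf ?gt_eqF // => /(_ erefl).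
  rewrite -scalemxAl normrZ ger0_norm ?invr_ge0 // ler_pdivlMl //.
  by rewrite mulrA mulr1 ler_pdivrMr ?mulr_gt0 // [leRHS]mulrC.
have Munit : M \in unitmx.
  rewrite -row_free_unit -kermx_eq0; apply/eqP/row_matrixP => i; rewrite row0.
  apply/eqP; rewrite -normr_le0; apply: (le_trans (low _)).
  by rewrite -row_mul mulmx_ker row0 normr0 mulr0.
pose a := w *m invmx M.
have aM : a *m M = w by rewrite /a mulmxKV.
have wE : w = \sum_i (a ord0 i / s) *: x s (ei i) T.
  rewrite -[LHS](scalerK (lt0r_neq0 s0)) -[in LHS]aM vM scaler_sumr.
  by apply: eq_bigr => i _; rewrite scalerA mulrC.
have Lx i : `|L (x s (ei i) T)| <= e * (s * Om).
  have [cT dT] := fwd s (ei i) s0 sr (ei1 i) T (ltac:(by rewrite T0 lexx)).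
  have := Hrho _ cT (le_trans dT srho); rewrite ES sub0r normrN => H.
  by apply: (le_trans H); rewrite ler_pM2l.
rewrite [in leLHS]wE Llin; apply: (le_trans (ler_norm_sum _ _ _)).
apply: (@le_trans _ _ (\sum_(i < n) (2 * Om * `|w|) * Om * e)).
  apply: ler_sum => i _; rewrite normrZ normrM (gtr0_norm (_ : 0 < s^-1)) ?invr_gt0 //.
  apply: (@le_trans _ _ (`|a ord0 i| / s * (e * (s * Om)))).
    by apply: ler_wpM2l; [rewrite divr_ge0 // ltW | exact: Lx].
  have -> : `|a ord0 i| / s * (e * (s * Om)) = `|a ord0 i| * (Om * e).
    by field; rewrite gt_eqF.
  rewrite -mulrA ler_wpM2r ?mulr_ge0 ?(ltW Om0) ?(ltW e_gt0) //.
  by apply: (le_trans (rV_coord_le _ _)); rewrite -[in leRHS]aM; exact: low.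
by rewrite sumr_const card_ord -[leLHS]mulr_natl !mulrA.
Qed.

End Spanning.
End LinearSystem.

(** * Cocycles on a connected group *)

(** Gronwall for the distance to f 0, with growth rate 0 and arbitrarily small
B. *)
Lemma zero_derivative_const (R : realType) (V : normedModType R) (f : R -> V) :
  (forall t : R, 0 <= t <= 1 -> forall e : R, 0 < e ->
     \forall s \near t, `|f s - f t| <= e * `|s - t|) -> f 1 = f 0.
Proof.
move=> df.
have cf t : 0 <= t <= 1 -> {for t, continuous f}.
  move=> t1; apply/cvgrPdist_le => e e0.
  have n1 : \forall s \near t, `|s - t| <= e.
    apply/(@nbhs_ballP R _ t); exists e => //= s; rewrite distrC; exact: ltW.
  apply: filterS2 n1 (df t t1 1 ltr01) => s s1 fs.
  by rewrite distrC; apply: (le_trans fs); rewrite mul1r.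
apply/eqP; rewrite -subr_eq0 -normr_le0.
apply: (@le0_small _ _ (expR ((0 + 2) * 1)) 1) => // B /andP[B0 _].
have gr := @gronwall R 1 0 B (fun t => `|f t - f 0|) (fun=> True) ler01 (lexx 0) B0.
suff H t : 0 <= t <= 1 -> True /\ `|f t - f 0| <= B * expR ((0 + 2) * t).
  by have [] := H 1; rewrite ?lexx ?ler01 // mulrC.
move: t; apply: gr => //.
- by rewrite subrr normr0 ltW.
- move=> t /andP[t0 t1] _ _ e e0.
  have tT : 0 <= t <= 1 by rewrite t0 ltW.
  have [d d0 Hd] := near_right (df t tT e e0).
  exists d => // s sd; split => //.
  have -> : f s - f 0 = (f t - f 0) + (f s - f t) by rewrite [RHS]addrC addrA subrK.
  apply: (le_trans (ler_normD _ _)); rewrite lerD2l.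
  have st : 0 < s - t by lra.
  apply: (le_trans (Hd s sd)); rewrite gtr0_norm // mulrC ler_pM2l // mul0r add0r.
  by rewrite lerDr ltW.
- move=> t tT H; split => //.
  have t01 : 0 <= t <= 1 by case/andP: tT => t0 ->; rewrite ltW.
  set b := _ * expR _.
  have clb : closed [set u : V | `|u - f 0| <= b].
    have -> : [set u : V | `|u - f 0| <= b] = closed_ball_ Num.norm (f 0) b.
      by apply/seteqP; split => u; rewrite /closed_ball_ /= distrC.
    exact: closed_closed_ball_.
  have t0' : 0 < t by case/andP: tT.
  apply: (left_closed clb (cf t t01) t0') => s sb.
  have [_ fs] := H s sb; apply: (le_trans fs).
  rewrite ler_wpM2l ?(ltW B0) // ler_expR ler_wpM2l ?add0r //.
  by case/andP: sb => _ /ltW.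
Qed.

Lemma diff_partial (R : realType) (V W X : normedModType R) (f : V * W -> X) a b v :
  differentiable f (a, b) -> 'd f (a, b) (v, 0) = 'd (fun x => f (x, b)) a v.
Proof.
move=> df.
have did : differentiable id a by exact: ex_diff.
have := diff_comp_pair v did (differentiable_cst b a) df.
by rewrite diffid diffcst.
Qed.

Section RightTranslation.
Variables (R : realType) (n : nat) (G : lieGroupType R n).

Local Notation c1 := (chart_at (1%g : G)).
Local Notation o := (chart c1 (1%g : G)).
Local Notation cm := (chart_mul c1 c1 c1).
Local Notation RT p := (D_in c1 c1 (fun g : G => g * p)%g 1%g).

Lemma right_translation_partial p v : chart_dom c1 p ->
  RT p v = 'D_(v, 0) cm (o, chart c1 p).
Proof.
move=> cp.
have df : differentiable cm (o, chart c1 p).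
  by apply: chart_mul_diff => //; [exact: chart_atP | rewrite mul1g].
have FE : (fun x => cm (x, chart c1 p)) =
    chart c1 \o (fun g : G => g * p)%g \o chart_inv c1.
  by apply/funext => x; rewrite /chart_mul /= chartK.
by rewrite (deriveE _ df) (diff_partial v df) FE.
Qed.

Lemma chart_mul_partial_cont v : {for o, continuous (fun y => 'D_(v, 0) cm (o, y))}.
Proof.
have [_ /(_ (v, 0)) cD] := @mulg_smooth _ _ G c1 c1 c1 1%N.
have H := cD (o, o).
have dp : differentiable (fun y : 'rV[R]_n => (o, y)) o.
  by apply: differentiable_pair; [exact: differentiable_cst | exact: ex_diff].
have h := differentiable_continuous dp.
have c11 := chart_atP (1%g : G).
have oP : [set z : ('rV[R]_n * 'rV[R]_n)%type |
    [/\ (chart c1 @` chart_dom c1) z.1, (chart c1 @` chart_dom c1) z.2 &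
        chart_dom c1 (chart_inv c1 z.1 * chart_inv c1 z.2 : G)%g]] (o, o).
  by split => /=; [exists 1%g|exists 1%g|rewrite chartK // mulg1].
exact: (continuous_comp h (H oP)).
Qed.

(** The partial derivative of the smooth multiplication depends continuously on the
other factor, and is the identity when that factor is the identity. *)
Lemma right_translation_near1 (d : R) : 0 < d -> exists2 rho, 0 < rho &
  forall p, chart_dom c1 p -> dist1 p <= rho -> forall v, `|RT p v - v| <= d * `|v|.
Proof.
move=> d0.
have dn0 : 0 < d / (1 + n%:R) by rewrite divr_gt0 // ltr_pwDl.
have c11 := chart_atP (1%g : G).
have nii (i : 'I_n) : \forall y \near o,
    `|'D_(delta_mx ord0 i, 0) cm (o, o) - 'D_(delta_mx ord0 i, 0) cm (o, y)| <= d / (1 + n%:R).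
  exact: (cvgr_dist_le _ _ (@chart_mul_partial_cont (delta_mx ord0 i)) _ dn0).
have ni : \forall y \near o, forall i : 'I_n,
   `|'D_(delta_mx ord0 i, 0) cm (o, o) - 'D_(delta_mx ord0 i, 0) cm (o, y)| <= d / (1 + n%:R).
  exact: filter_forall nii.
have [rho rho0 Hrho] := near_chart ni.
exists rho => // p cp dp v.
have Hi i : `|RT p (delta_mx ord0 i) - delta_mx ord0 i| <= d / (1 + n%:R).
  have := Hrho _ dp i; rewrite -right_translation_partial // -right_translation_partial // distrC.
  have -> : (fun g : G => (g * 1)%g) = (fun g : G => g) by apply/funext => g; rewrite mulg1.
  by rewrite D_in_id.
have -> : RT p v - v = \sum_i v ord0 i *: (RT p (delta_mx ord0 i) - delta_mx ord0 i).
  under [RHS]eq_bigr do rewrite scalerBr.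
  rewrite sumrB -row_sum_delta; congr (_ - _).
  rewrite {1}(row_sum_delta v) /D_in linear_sum; apply: eq_bigr => i _.
  by rewrite linearZ.
apply: (le_trans (ler_norm_sum _ _ _)).
apply: (@le_trans _ _ (\sum_(i < n) `|v| * (d / (1 + n%:R)))).
  by apply: ler_sum => i _; rewrite normrZ ler_pM // rV_coord_le.
rewrite sumr_const card_ord -[leLHS]mulr_natl.
have -> : n%:R * (`|v| * (d / (1 + n%:R))) = d * `|v| * (n%:R / (1 + n%:R)).
  by field; rewrite gt_eqF // ltr_pwDl.
rewrite -[leRHS]mulr1 ler_wpM2l ?mulr_ge0 ?(ltW d0) //.
by rewrite ler_pdivrMr ?ltr_pwDl // mul1r lerDr.
Qed.

End RightTranslation.

(** A first-order expansion at the identity; at p = 1 it forces E 1 = L 0. *)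
Definition approx1 (R : realType) (n : nat) (G : lieGroupType R n)
    (W : normedModType R) (E : G -> W) (L : 'rV[R]_n -> W) :=
  forall e : R, 0 < e -> exists2 rho : R, 0 < rho &
    forall p, chart_dom (chart_at (1%g : G)) p -> dist1 p <= rho ->
    `|E p - L (chart (chart_at (1%g : G)) p - chart (chart_at (1%g : G)) 1%g)| <= e * dist1 p.

(** Trivialization only multiplies the field by a matrix that tends to the identity,
so the field and its trivialization have the same linear part. *)
Lemma right_field_approx (R : realType) (n : nat) (G : lieGroupType R n)
    (J : finType) (X : J -> vector_field G) (j : J) :
  (forall j, linear_field (X j)) -> approx1 (right_field (X j)) (Dfield X j).
Proof.
move=> Xlin e e0.
have [r [A [r0 A0 _ _ NA]]] := near_identity Xlin.
have [rho1 rho10 H1] := near_chart (field_in_approx Xlin j (divr_gt0 e0 (ltr0Sn R 1))).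
(* 1 / 2 bounds the trivialized field by twice the field; e / (4 A) makes the difference small *)
pose d := Num.min (1 / 2) (e / (4 * A)).
have d0 : 0 < d by rewrite lt_min !divr_gt0 // mulr_gt0.
have d2 : d <= 1 / 2 by rewrite ge_min lexx.
have dA : d <= e / (4 * A) by rewrite ge_min lexx orbT.
have [rho2 rho20 H2] := right_translation_near1 G d0.
exists (Num.min r (Num.min rho1 rho2)); first by rewrite !lt_min r0 rho10.
move=> p cp; rewrite !le_min => /and3P[pr p1 p2].
set D := Dfield _ _ _; set x := right_field _ _; set y := dist1 p.
pose Nx := field_in (chart_at (1%g : G)) (X j) (chart (chart_at (1%g : G)) p).
have NxA : `|Nx| <= A * y := NA j _ pr.
have ND : `|Nx - D| <= e / 2 * y := H1 _ p1.
have xN : `|Nx - x| <= d * `|x| by rewrite /Nx field_in_chart //; exact: H2.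
have y0 : 0 <= y by exact: normr_ge0.
have xle : `|x| <= `|Nx| + `|Nx - x|.
  have {1}-> : x = Nx - (Nx - x) by rewrite opprB addrC subrK.
  exact: ler_normB.
have xle2 : `|x| <= 2 * `|Nx|.
  have : d * `|x| <= 1 / 2 * `|x| by rewrite ler_wpM2r.
  by lra.
have -> : x - D = (Nx - D) - (Nx - x) by rewrite opprB [RHS]addrC addrA subrK.
apply: (le_trans (ler_normB _ _)).
have : d * `|x| <= e / 2 * y.
  apply: (@le_trans _ _ (e / (4 * A) * (2 * (A * y)))).
    rewrite ler_pM ?(ltW d0) //; apply: (le_trans xle2); rewrite ler_pM2l //.
  by rewrite le_eqVlt; apply/orP; left; apply/eqP; field; rewrite gt_eqF.
by lra.
Qed.

Section Cocycle.
Variables (R : realType) (n : nat) (G : lieGroupType R n).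
Variables (W : normedModType R) (E : G -> W).
Hypothesis Ebound : forall g : G, exists2 B : R, 0 < B &
  forall h, `|E (g * h)%g - E g| <= B * `|E h|.
Hypothesis Esmall : approx1 E (fun=> 0).

Local Notation c1 := (chart_at (1%g : G)).

(** By the cocycle bound, the increment of E between g and gh is controlled by
E h, which is of smaller order than the distance of h to the identity. *)
Lemma cocycle_flat (c : atlas G) (g : G) : chart_dom c g -> forall e : R, 0 < e ->
  \forall y \near chart c g, `|E (chart_inv c y) - E g| <= e * `|y - chart c g|.
Proof.
move=> cg e e0.
have [B B0 HB] := Ebound g.
have gg : (g^-1 * g = 1)%g by rewrite mulVg.
have [_ _ cl dl] : diff_in c c1 (fun h : G => g^-1 * h)%g g.
  by apply: left_diff_in => //; rewrite gg; exact: chart_atP.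
set f := chart c1 \o _ \o _ in dl.
have fo : f (chart c g) = chart c1 1%g by rewrite /f /= chartK // gg.
have [K K0 HK] := diff_bound dl.
have e'0 : 0 < e / (B * (K + 1)).
  by rewrite divr_gt0 // mulr_gt0 //; lra.
have [rho rho0 Hrho] := Esmall e'0.
have nd := diff_approx dl ltr01.
have cinv : (g^-1 * chart_inv c y)%g @[y --> chart c g] --> (g^-1 * g)%g.
  exact: (mul_cvg _ (cvg_cst _) (chart_inv_cont cg)).
rewrite gg in cinv.
have nc : \forall y \near chart c g, chart_dom c1 (g^-1 * chart_inv c y)%g.
  exact: cinv _ (chart_dom_near (chart_atP (1%g : G))).
have nr : \forall y \near chart c g, `|f (chart c g) - f y| <= rho.
  exact: (cvgr_dist_le _ _ (differentiable_continuous dl) _ rho0).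
near=> y.
have cy : chart_dom c1 (g^-1 * chart_inv c y)%g by near: y.
have fy : `|f (chart c g) - f y| <= rho by near: y.
have dy : `|f y - f (chart c g) - 'd f (chart c g) (y - chart c g)| <= 1 * `|y - chart c g|.
  by near: y.
pose h := (g^-1 * chart_inv c y)%g.
have -> : chart_inv c y = (g * h)%g by rewrite /h mulVKg.
apply: (le_trans (HB h)).
have dh : dist1 h <= rho by rewrite /dist1 distrC -fo.
have := Hrho h cy dh; rewrite subr0 => Eh.
have dhy : dist1 h <= (K + 1) * `|y - chart c g|.
  have -> : dist1 h = `|f y - f (chart c g)| by rewrite fo.
  rewrite -[f y - _](subrK ('d f (chart c g) (y - chart c g))).
  by apply: (le_trans (ler_normD _ _)); rewrite addrC mulrDl lerD.
apply: (@le_trans _ _ (B * (e / (B * (K + 1)) * ((K + 1) * `|y - chart c g|)))).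
  by rewrite ler_pM2l //; apply: (le_trans Eh); rewrite ler_pM2l.
rewrite le_eqVlt; apply/orP; left; apply/eqP; field; rewrite !gt_eqF //; lra.
Unshelve. all: by end_near. Qed.

Lemma cocycle_locally_const (g : G) : \forall q \near g, E q = E g.
Proof.
pose c := chart_at g; have cg : chart_dom c g := chart_atP g.
have /(@nbhs_ballP R _ (chart c g))[d /= d0 Hd] := chart_img_near cg.
have nb : \forall q \near g, ball (chart c g) d (chart c q).
  by apply: (chart_continuous _ _ cg); exact: nbhsx_ballx.
apply: filterS2 nb (chart_dom_near cg) => q bq cq.
(* the segment from g to q in the chart *)
pose l (s : R) : 'rV[R]_n := chart c g + s *: (chart c q - chart c g).
have l1 : l 1 = chart c q by rewrite /l scale1r addrC subrK.
have l0 : l 0 = chart c g by rewrite /l scale0r addr0.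
have lim s : 0 <= s <= 1 -> (chart c @` chart_dom c) (l s).
  move=> /andP[s0 s1]; apply: Hd; rewrite -ball_normE /= /l opprD addrA subrr add0r normrN.
  move: bq; rewrite -ball_normE /= distrC => bq.
  rewrite normrZ ger0_norm //; apply: le_lt_trans bq.
  by rewrite -[leRHS]mul1r ler_wpM2r.
have := @zero_derivative_const R W (fun s => E (chart_inv c (l s))).
rewrite l1 l0 !chartK //; apply => t t01 e e0.
have [ct ctE] := chart_invK (lim t t01).
pose D := 1 + `|chart c q - chart c g|.
have D0 : 0 < D by rewrite ltr_pwDl.
have := cocycle_flat ct (divr_gt0 e0 D0); rewrite ctE => flat.
have lc : {for t, continuous l}.
  have : differentiable l t by [].
  exact: differentiable_continuous.
have nl : \forall s \near t, `|E (chart_inv c (l s)) - E (chart_inv c (l t))| <=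
   e / D * `|l s - l t| by exact: (lc _ flat).
apply: filterS nl => s H; apply: (le_trans H).
have -> : l s - l t = (s - t) *: (chart c q - chart c g).
  by rewrite /l opprD addrACA subrr add0r scalerBl.
rewrite normrZ; set z := `|chart c q - _|; set w := `|s - t|.
have -> : e / D * (w * z) = e * w * (z / D) by field; rewrite gt_eqF.
rewrite -[leRHS]mulr1 ler_wpM2l ?mulr_ge0 ?(ltW e0) //.
  exact: normr_ge0.
by rewrite ler_pdivrMr // mul1r /D lerDr.
Qed.

Lemma cocycle_eq0 : connected [set: G] -> E 1%g = 0 -> forall g, E g = 0.
Proof.
move=> conn E1 g.
have opA (A : set W) : open [set g | A (E g)].
  rewrite openE => q Aq; rewrite /interior /=.
  by apply: filterS (cocycle_locally_const q) => q' Eq; rewrite /= Eq.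
have := conn [set g | E g = 0] _ _ _.
have A0 : [set g | E g = 0] !=set0 by exists 1%g.
have Ao : open [set g | E g = 0] by exact: (opA [set 0]).
have Ac : closed [set g | E g = 0].
  by rewrite -[[set g | E g = 0]]setCK; apply: open_closedC; exact: (opA (~` [set 0])).
move=> /(_ A0 (ex_intro2 _ _ _ Ao (esym (setTI _))) (ex_intro2 _ _ _ Ac (esym (setTI _)))).
by move=> AE; have : [set: G] g by []; rewrite -AE.
Qed.

End Cocycle.

(** * Primitives of locally essentially bounded functions *)

Section Primitive.
Variable R : realType.
Local Notation mu := (@lebesgue_measure R).

Definition ess_bounded (a b : R) (f : R -> R) (B : R) :=
  {ae mu, forall t, a <= t <= b -> `|f t| <= B}.

(** The integral is taken in the extended reals since integrability is only a
consequence. *)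
Lemma ess_bounded_int (a b B : R) (f : R -> R) :
  measurable_fun `[a, b] f -> a <= b -> 0 <= B -> ess_bounded a b f B ->
  (\int[mu]_(t in `[a, b]) `|(f t)%:E| <= (B * (b - a))%:E)%E.
Proof.
move=> mf ab B0 fB.
have muE : (B%:E * mu `[a, b] = (B * (b - a))%:E)%E.
  rewrite lebesgue_measure_itv /= lte_fin; case: ltP => ab'; first by rewrite -EFinB EFinM.
  by have -> : b - a = 0; [apply/eqP; rewrite subr_eq0; apply/eqP/le_anti/andP; split|rewrite mule0 mulr0].
rewrite -muE; apply: integral_le_bound => //; first exact/measurable_EFinP.
Qed.

Lemma ess_bounded_integrable (a b B : R) (f : R -> R) :
  measurable_fun `[a, b] f -> a <= b -> 0 <= B -> ess_bounded a b f B ->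
  mu.-integrable `[a, b] (EFin \o f).
Proof.
move=> mf ab B0 fB; apply/integrableP; split; first exact/measurable_EFinP.
by apply: (le_lt_trans (ess_bounded_int mf ab B0 fB)); rewrite ltry.
Qed.

Lemma Rintegral_ess_bound (a b B : R) (f : R -> R) :
  measurable_fun `[a, b] f -> a <= b -> 0 <= B -> ess_bounded a b f B ->
  `|\int[mu]_(t in `[a, b]) f t| <= B * (b - a).
Proof.
move=> mf ab B0 fB; have fi := ess_bounded_integrable mf ab B0 fB.
rewrite -lee_fin EFin_normr_Rintegral //.
apply: le_trans (ess_bounded_int mf ab B0 fB).
by apply: le_abse_integral => //; exact/measurable_EFinP.
Qed.

Lemma Rintegral_sum (I : Type) (r : seq I) (D : set R) (f : I -> R -> R) :
  measurable D -> (forall i, mu.-integrable D (EFin \o f i)) ->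
  \int[mu]_(t in D) (\sum_(i <- r) f i t) = \sum_(i <- r) \int[mu]_(t in D) f i t.
Proof.
move=> mD fi; elim: r => [|i r IH].
  rewrite big_nil -[RHS](mul0r (fine (mu D))) -Rintegral_cst //.
  by apply: eq_Rintegral => t _; rewrite big_nil.
rewrite big_cons -IH -RintegralD //.
  by apply: eq_Rintegral => t _; rewrite big_cons.
have := @integrable_sum _ _ R mu D mD I r xpredT (fun i => EFin \o f i) (fun i _ => fi i).
by apply: eq_integrable => // t _; rewrite /= sumEFin.
Qed.

Variable f : R -> R.
Hypothesis mf : measurable_fun setT f.
Hypothesis fb : forall a b, exists B, 0 <= B /\ ess_bounded a b f B.

Lemma primitive_integrable a b : mu.-integrable `[a, b] (EFin \o f).
Proof.
have [ab|ba] := leP a b; last first.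
  by rewrite set_itv_ge -?leNgt ?bnd_simp ?ltNge //; [exact: integrable_set0|rewrite -ltNge].
have [B [B0 fB]] := fb a b.
by apply: (ess_bounded_integrable _ ab B0 fB); apply: measurable_funS mf.
Qed.

Lemma integral_chasles a b c : a <= b -> b <= c ->
  \int[mu]_(t in `[a, c]) f t =
  \int[mu]_(t in `[a, b]) f t + \int[mu]_(t in `[b, c]) f t.
Proof.
move=> ab bc; apply/eqP; rewrite addrC -subr_eq; apply/eqP.
rewrite Rintegral_itvB ?bnd_simp //; last exact: primitive_integrable.
rewrite Rintegral_itv_obnd_cbnd //.
by apply: integrableS (primitive_integrable b c) => //; apply: subset_itvr; rewrite bnd_simp.
Qed.

(** The integral from 0 to t with its sign. *)
Definition primitive (t : R) : R :=
  if 0 <= t then \int[mu]_(s in `[0, t]) f s else - \int[mu]_(s in `[t, 0]) f s.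

Lemma primitiveB a b : a <= b -> primitive b - primitive a = \int[mu]_(s in `[a, b]) f s.
Proof.
move=> ab; rewrite /primitive; have [a0|a0] := leP 0 a.
  by rewrite (le_trans a0 ab) (integral_chasles a0 ab) addrC addKr.
have [b0|b0] := leP 0 b.
  by rewrite opprK (integral_chasles (ltW a0) b0) addrC.
by rewrite opprK (integral_chasles ab (ltW b0)) addrC addrK.
Qed.

Lemma primitive_lip a b B s t : 0 <= B -> ess_bounded a b f B ->
  a <= s <= b -> a <= t <= b -> `|primitive s - primitive t| <= B * `|s - t|.
Proof.
move=> B0 fB.
have main s' t' : a <= s' <= b -> a <= t' <= b -> s' <= t' ->
    `|primitive s' - primitive t'| <= B * `|s' - t'|.
  move=> /andP[as' sb] /andP[at' tb] st.
  rewrite distrC primitiveB // distrC (ger0_norm (_ : 0 <= t' - s')) ?subr_ge0 //.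
  apply: Rintegral_ess_bound => //; first exact: measurable_funS mf.
  have aeF := ae_filter_ringOfSetsType mu.
  apply: filterS fB => x Hx /andP[sx xt]; apply: Hx.
  by rewrite (le_trans as' sx) (le_trans xt tb).
move=> sab tab; have [st|/ltW ts] := leP s t; first exact: main.
by rewrite distrC [`|s - t|]distrC; exact: main.
Qed.

Lemma ess_bounded_locally_integrable : locally_integrable setT f.
Proof.
split => //; first exact: openT.
move=> K _ cK.
have [M [Mreal HM]] := compact_bounded cK.
pose N := `|M| + 1.
have KN : K `<=` `[- N, N]%classic.
  move=> x Kx /=; rewrite in_itv /= -ler_norml.
  by apply: HM Kx; rewrite /N (le_lt_trans (ler_norm M)) // ltrDl.
have KI : mu.-integrable K (EFin \o f).
  by apply: integrableS (primitive_integrable (- N) N) => //; exact: compact_measurable.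
by case/integrableP: KI.
Qed.

(** The points t are the Lebesgue points of f. The null set depends on f only: in
the application, one null set serves all trajectories of a control. *)
Lemma primitive_ae : {ae mu, forall t, forall e : R, 0 < e ->
  \forall s \near t, `|primitive s - primitive t - (s - t) * f t| <= e * `|s - t|}.
Proof.
have := lebesgue_differentiation ess_bounded_locally_integrable.
have aeF := ae_filter_ringOfSetsType mu.
apply: filterS => t lt e e0.
have tt : t < t + 1 by rewrite ltrDl.
(* the primitive from t - 1 differs from the primitive from 0 by a constant near t *)
have ti : mu.-integrable [set` Interval (BLeft (t - 1)) (BRight (t + 1))] (EFin \o f).
  exact: primitive_integrable.
have t1 : t - 1 <= t by lra.
have [|Fd FE] := FTC1_lebesgue_pt tt ti _ lt; first by rewrite lte_fin; lra.
have Fi := derivableP Fd; rewrite -derive1E FE in Fi.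
have := is_derive_approx Fi e0 => Fa.
have n1 : \forall s \near t, t - 1 <= s.
  apply/(@nbhs_ballP R _ t); exists 1 => //= s; rewrite /ball /= => st.
  by have := ltr_norml (t - s) 1; rewrite st => /esym/andP[_]; lra.
apply: filterS2 n1 Fa => s s1; apply: le_trans.
rewrite le_eqVlt; apply/orP; left; apply/eqP; congr `|_ - _|.
by rewrite -(primitiveB s1) -(primitiveB t1); ring.
Qed.

End Primitive.

(** * Controls and their primitives; from integral equations to logarithmic derivatives *)

Section Control.
Variables (R : realType) (m : nat) (u : R -> 'rV[R]_m).
Hypothesis uL : Linfty_loc u.
Local Notation mu := (@lebesgue_measure R).

(** The drift is treated as a field with the constant control 1. *)
Definition ctrl (j : 'I_m.+1) (t : R) : R :=
  if unlift ord0 j is Some i then u t ord0 i else 1.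

Definition ctrl_primitive (j : 'I_m.+1) : R -> R := primitive (ctrl j).

Lemma ctrl0 t : ctrl ord0 t = 1.
Proof. by rewrite /ctrl unlift_none. Qed.

Lemma ctrl_lift i t : ctrl (lift ord0 i) t = u t ord0 i.
Proof. by rewrite /ctrl liftK. Qed.

Lemma ctrl_measurable j : measurable_fun setT (ctrl j).
Proof.
rewrite /ctrl; case: (unlift ord0 j) => [i|]; first exact: uL.1.
exact: measurable_cst.
Qed.

Lemma ctrl_bounded a b : exists B, 0 <= B /\ forall j, ess_bounded a b (ctrl j) B.
Proof.
have [B HB] := uL.2 a b; exists (`|B| + 1); split; first by rewrite addr_ge0.
have aeF := ae_filter_ringOfSetsType mu.
move=> j; apply: filterS HB => t Ht tab; rewrite /ctrl.
case: (unlift ord0 j) => [i|]; last by rewrite normr1 lerDr.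
apply: (le_trans (rV_coord_le _ _)); apply: (le_trans (Ht tab)).
by apply: (le_trans (ler_norm _)); rewrite lerDl.
Qed.

Lemma ctrl_bounded1 j a b : exists B, 0 <= B /\ ess_bounded a b (ctrl j) B.
Proof. by have [B [B0 HB]] := ctrl_bounded a b; exists B; split. Qed.

Lemma ctrl_primitive_loc_lip : loc_lip ctrl_primitive.
Proof.
move=> T; have [B [B0 HB]] := ctrl_bounded (- T) T.
exists (B + 1); first by rewrite ltr_pwDr.
move=> j s t sT tT; rewrite !ler_norml in sT tT.
rewrite /ctrl_primitive.
apply: le_trans
  (primitive_lip (ctrl_measurable j) (ctrl_bounded1 j) B0 (HB j) sT tT) _.
by rewrite ler_wpM2r // lerDl.
Qed.

Lemma ctrl_primitive_ae : {ae mu, forall t, forall j (e : R), 0 < e ->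
  \forall s \near t, `|ctrl_primitive j s - ctrl_primitive j t - (s - t) * ctrl j t| <= e * `|s - t|}.
Proof.
have aeF := ae_filter_ringOfSetsType mu.
apply: filter_forall => j.
exact: (primitive_ae (ctrl_measurable j) (ctrl_bounded1 j)).
Qed.

Lemma ctrl_combination (V : lmodType R) (a : 'I_m.+1 -> V) t :
  \sum_j ctrl j t *: a j = a ord0 + \sum_(i < m) u t ord0 i *: a (lift ord0 i).
Proof.
rewrite big_ord_recl ctrl0 scale1r; congr (_ + _).
by apply: eq_bigr => i _; rewrite ctrl_lift.
Qed.

(** Freezing the continuous coefficients a_j at time t turns the integral of
sum_j u_j a_j into sum_j a_j(t) (U_j(q) - U_j(p)); the error is small against
q - p, as the u_j are essentially bounded. *)
Lemma ctrl_primitive_increment (t e : R) (a : 'I_m.+1 -> R -> R) : 0 < e ->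
  (\forall s \near t, forall j, {for s, continuous (a j)}) ->
  \forall s \near t, forall p q, p <= q -> (p = t /\ q = s) \/ (p = s /\ q = t) ->
    `|\int[mu]_(x in `[p, q]) (\sum_j ctrl j x * a j x) -
      \sum_j (ctrl_primitive j q - ctrl_primitive j p) * a j t| <= e * (q - p).
Proof.
move=> e0 ca.
have [B [B0 HB]] := ctrl_bounded (t - 1) (t + 1).
have m0 : 0 < m.+1%:R * (B + 1) :> R by rewrite mulr_gt0 // ltr_pwDr.
pose e' := e / (m.+1%:R * (B + 1)).
have e'0 : 0 < e' by rewrite divr_gt0.
have ctj j : \forall s \near t, `|a j t - a j s| <= e'.
  have := nbhs_singleton ca j => caj; exact: (cvgr_dist_le _ _ caj _ e'0).
have ct : \forall s \near t, forall j, `|a j t - a j s| <= e' by exact: filter_forall ctj.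
have [d /= d0 Hd] := (@nbhs_ballP R _ t _).1 (filterI ca ct).
apply/(@nbhs_ballP R _ t); exists (Num.min d 1); first by rewrite /= lt_min d0 ltr01.
move=> s; rewrite /ball /= lt_min => /andP[sd s1] p q pq pts.
have in1 x : p <= x <= q -> `|t - x| <= `|t - s|.
  move=> /andP[px xq]; case: pts => -[pE qE]; rewrite pE qE in pq px xq.
    by rewrite !ler0_norm ?subr_le0 //; lra.
  by rewrite !ger0_norm ?subr_ge0 //; lra.
have inball x : p <= x <= q -> (forall j, {for x, continuous (a j)}) /\
    (forall j, `|a j t - a j x| <= e').
  by move=> /in1 xt; apply: Hd; rewrite /ball /=; apply: le_lt_trans sd.
have inab x : p <= x <= q -> t - 1 <= x <= t + 1.
  by move=> /in1 /le_lt_trans/(_ s1); rewrite ltr_norml => /andP[? ?]; apply/andP; split; lra.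
have cm j : measurable_fun `[p, q] (ctrl j) by apply: measurable_funS (ctrl_measurable j).
have am j : measurable_fun `[p, q] (a j).
  apply: subspace_continuous_measurable_fun; first exact: measurable_itv.
  apply: continuous_in_subspaceT => x; rewrite inE /= in_itv /= => xpq.
  exact: (inball x xpq).1.
have cb j : ess_bounded p q (ctrl j) B.
  have aeF := ae_filter_ringOfSetsType mu.
  by apply: filterS (HB j) => x Hx xpq; apply: Hx; exact: inab.
pose g j x := ctrl j x * (a j x - a j t).
have gm j : measurable_fun `[p, q] (g j).
  by apply: measurable_funM => //; apply: measurable_funB => //; exact: measurable_cst.
have gb j : ess_bounded p q (g j) (B * e').
  have aeF := ae_filter_ringOfSetsType mu.
  apply: filterS (cb j) => x Hx xpq; rewrite /g normrM ler_pM //; first exact: Hx.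
  by rewrite distrC; exact: (inball x xpq).2.
have Be0 : 0 <= B * e' by rewrite mulr_ge0 // ltW.
have gi j := ess_bounded_integrable (gm j) pq Be0 (gb j).
have ci j : mu.-integrable `[p, q] (EFin \o ctrl j) := ess_bounded_integrable (cm j) pq B0 (cb j).
have cai j : mu.-integrable `[p, q] (EFin \o (fun x => ctrl j x * a j t)).
  apply: (@ess_bounded_integrable _ _ _ (B * `|a j t|)) => //.
  - by apply: measurable_funM => //; exact: measurable_cst.
  - by rewrite mulr_ge0.
  - have aeF := ae_filter_ringOfSetsType mu.
    by apply: filterS (cb j) => x Hx xpq; rewrite normrM ler_wpM2r //; exact: Hx.
have split_int : \int[mu]_(x in `[p, q]) (\sum_j ctrl j x * a j x) =
    \sum_j (\int[mu]_(x in `[p, q]) g j x + (ctrl_primitive j q - ctrl_primitive j p) * a j t).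
  rewrite -[LHS](@eq_Rintegral _ _ _ mu `[p, q]
    (fun x => \sum_j ctrl j x * a j x) (fun x => \sum_j (g j x + ctrl j x * a j t))); last first.
    by move=> x _; apply: eq_bigr => j _; rewrite /g; ring.
  rewrite Rintegral_sum //; last first.
    move=> j; have H := @integrableD _ _ R mu `[p, q] (measurable_itv _) _ _ (gi j) (cai j).
    by apply: eq_integrable H => //.
  apply: eq_bigr => j _; rewrite RintegralD //; congr (_ + _).
  rewrite RintegralZr //; congr (_ * _).
  by rewrite /ctrl_primitive (primitiveB (ctrl_measurable j) (ctrl_bounded1 j) pq).
rewrite split_int big_split /= addrK.
apply: (le_trans (ler_norm_sum _ _ _)).
apply: (@le_trans _ _ (\sum_(j < m.+1) B * e' * (q - p))).
  by apply: ler_sum => j _; exact: (Rintegral_ess_bound (gm j) pq Be0 (gb j)).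
rewrite sumr_const card_ord -[leLHS]mulr_natl.
have -> : m.+1%:R * (B * e' * (q - p)) = e * (q - p) * (B / (B + 1)).
  by rewrite /e'; field; rewrite !gt_eqF // ltr_pwDr.
rewrite -[leRHS]mulr1 ler_wpM2l ?mulr_ge0 ?subr_ge0 ?(ltW e0) //.
by rewrite ler_pdivrMr ?ltr_pwDr // mul1r lerDl.
Qed.

End Control.

Section Solutions.
Variables (R : realType) (n m : nat) (G : lieGroupType R n).
Variables (X Z : 'I_m.+1 -> vector_field G).
Variables (u : R -> 'rV[R]_m) (gam : R -> G).
Hypothesis uL : Linfty_loc u.
Hypothesis gsol : is_solution (affine_velocity X Z) u gam.

Lemma affine_velocityE t g :
  affine_velocity X Z (u t) g = \sum_j ctrl u j t *: (X j g + Z j g).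
Proof. by rewrite ctrl_combination. Qed.

(** The integral equation in a chart c, with the fields frozen at time t. *)
Lemma solution_has_mder (c : atlas G) t : chart_dom c (gam t) ->
  has_mder (ctrl_primitive u) (chart c \o gam) t
    (fun j => coords_in c (gam t) (X j (gam t) + Z j (gam t))).
Proof.
move=> ct e e0.
have [cgam gint] := gsol.
pose a j s := coords_in c (gam s) (X j (gam s) + Z j (gam s)).
have nct : \forall s \near t, chart_dom c (gam s) by exact: (cgam t _ (chart_dom_near ct)).
have afield j s : chart_dom c (gam s) ->
    a j s = field_in c (X j) (chart c (gam s)) + field_in c (Z j) (chart c (gam s)).
  move=> cs; rewrite /a /field_in chartK //.
  by rewrite !(coords_inE _ cs) /D_in linearD.
have cfield (Y : vector_field G) s : chart_dom c (gam s) ->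
    {for s, continuous (fun r => field_in c Y (chart c (gam r)))}.
  move=> cs; have [sm _] := vf_smooth Y c 1%N.
  have df : differentiable (field_in c Y) (chart c (gam s)) by apply: sm; exists (gam s).
  have h : {for s, continuous (chart c \o gam)}.
    exact: (continuous_comp (cgam s) (chart_continuous _ _ cs)).
  exact: (continuous_comp h (differentiable_continuous df)).
have ca j s : chart_dom c (gam s) -> {for s, continuous (a j)}.
  move=> cs.
  have h : {for s, continuous (fun r => field_in c (X j) (chart c (gam r)) +
      field_in c (Z j) (chart c (gam r)))}.
    exact: (continuousD (cfield (X j) s cs) (cfield (Z j) s cs)).
  have ncs : \forall r \near s, chart_dom c (gam r) by exact: (cgam s _ (chart_dom_near cs)).
  have h2 : a j @ s --> field_in c (X j) (chart c (gam s)) + field_in c (Z j) (chart c (gam s)).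
    by apply: cvg_trans h; apply: near_eq_cvg; apply: filterS ncs => r cr; rewrite afield.
  by rewrite -(afield j s cs) in h2.
have inc k : \forall s \near t, forall p q, p <= q -> (p = t /\ q = s) \/ (p = s /\ q = t) ->
    `|\int[@lebesgue_measure R]_(x in `[p, q]) (\sum_j ctrl u j x * a j x ord0 k) -
      \sum_j (ctrl_primitive u j q - ctrl_primitive u j p) * a j t ord0 k| <= e * (q - p).
  apply: (ctrl_primitive_increment uL (a := fun j x => a j x ord0 k) e0).
  apply: filterS nct => s cs j.
  exact: (continuous_comp (ca j s cs) (@coord_continuous _ _ _ ord0 k _)).
have incn : \forall s \near t, forall k p q, p <= q ->
    (p = t /\ q = s) \/ (p = s /\ q = t) ->
    `|\int[@lebesgue_measure R]_(x in `[p, q]) (\sum_j ctrl u j x * a j x ord0 k) -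
      \sum_j (ctrl_primitive u j q - ctrl_primitive u j p) * a j t ord0 k| <= e * (q - p).
  exact: filter_forall inc.
have [d /= d0 Hd] := (@nbhs_ballP R _ t _).1 (filterI nct incn).
apply/(@nbhs_ballP R _ t); exists d => // s sd.
have [cs incs] := Hd s sd.
have dompq p q : p <= q -> (p = t /\ q = s) \/ (p = s /\ q = t) ->
    forall x, p <= x <= q -> chart_dom c (gam x).
  move=> pq pts x /andP[px xq]; apply: (Hd _ _).1; rewrite /ball /=.
  move: sd; rewrite /ball /= => sd; apply: le_lt_trans sd.
  case: pts => -[pE qE]; rewrite pE qE in pq px xq.
    by rewrite !ler0_norm ?subr_le0 //; lra.
  by rewrite !ger0_norm ?subr_ge0 //; lra.
apply: rV_norm_le => [|k]; first by rewrite mulr_ge0 // ltW.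
have main p q : p <= q -> (p = t /\ q = s) \/ (p = s /\ q = t) ->
    `|chart c (gam q) ord0 k - chart c (gam p) ord0 k -
      \sum_j (ctrl_primitive u j q - ctrl_primitive u j p) * a j t ord0 k| <= e * (q - p).
  move=> pq pts; apply: le_trans (incs k p q pq pts).
  rewrite (gint c p q pq (dompq p q pq pts) k).
  rewrite le_eqVlt; apply/orP; left; apply/eqP; congr `|_ - _|.
  apply: eq_Rintegral => x; rewrite inE /= in_itv /= => xpq.
  have cx := dompq p q pq pts x xpq.
  rewrite affine_velocityE coords_inE // /D_in linear_sum summxE; apply: eq_bigr => j _.
  by rewrite linearZ mxE /a coords_inE.
have sumE p q : (\sum_j (ctrl_primitive u j q - ctrl_primitive u j p) *: a j t) ord0 k =
    \sum_j (ctrl_primitive u j q - ctrl_primitive u j p) * a j t ord0 k.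
  by rewrite summxE; apply: eq_bigr => j _; rewrite mxE.
have [ts|/ltW st] := leP t s.
  have := main t s ts (or_introl (conj erefl erefl)).
  by rewrite -sumE /= !mxE (ger0_norm (_ : 0 <= s - t)) // subr_ge0.
have := main s t st (or_intror (conj erefl erefl)).
rewrite -sumE /= !mxE (ler0_norm (_ : s - t <= 0)) ?subr_le0 // opprB.
apply: le_trans; rewrite -normrN le_eqVlt; apply/orP; left; apply/eqP; congr `|_|.
rewrite !sumE opprB !opprD opprK addrC; congr (_ + _); first by rewrite addrC.
by rewrite -sumrN; apply: eq_bigr => j _; ring.
Qed.

Lemma solution_log_mder (Zinv : forall j, right_invariant (Z j)) t :
  log_mder (ctrl_primitive u) gam t (fun j => right_field (X j) (gam t) + Z j 1%g).
Proof.
have lt := loc_lip_at t (ctrl_primitive_loc_lip uL).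
have cg := chart_atP (gam t).
have := log_mder_of_chart lt (gsol.1 t) cg (solution_has_mder cg).
congr (log_mder _ _ _ _); apply/funext => j.
rewrite coords_inE // D_in_id // -(right_invariant_rtriv (gam t) (Zinv j)).
by rewrite /right_field /rtriv /D_in linearD.
Qed.

End Solutions.

(** * Homomorphisms, flows and controlled trajectories *)

(** In the quotient rule the constants w cancel, and the cocycle identity turns the
difference of the fields at eta t and gam t into the field at the quotient. *)
Lemma quotient_solves (R : realType) (n : nat) (G : lieGroupType R n) (J : finType)
    (X : J -> vector_field G) (w : J -> 'rV[R]_n) (U : J -> R -> R) (gam eta : R -> G) :
  (forall j, linear_field (X j)) -> loc_lip U ->
  (forall t, log_mder U gam t (fun j => right_field (X j) (gam t) + w j)) ->
  (forall t, log_mder U eta t (fun j => right_field (X j) (eta t) + w j)) ->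
  solves X U (fun t => (gam t)^-1 * eta t)%g.
Proof.
move=> Xlin Ul dg de t.
have := log_mder_quot (loc_lip_at t Ul) (dg t) (de t).
congr (log_mder _ _ _ _); apply/funext => j.
rewrite (linear_field_cocycle (gam t) ((gam t)^-1 * eta t)%g (Xlin j)) mulVKg.
by rewrite opprD addrACA subrr addr0.
Qed.

Lemma affine_unique (R : realType) (n : nat) (G : lieGroupType R n) (J : finType)
    (X : J -> vector_field G) (w : J -> 'rV[R]_n) (U : J -> R -> R) (gam eta : R -> G) :
  (forall j, linear_field (X j)) -> loc_lip U ->
  (forall t, log_mder U gam t (fun j => right_field (X j) (gam t) + w j)) ->
  (forall t, log_mder U eta t (fun j => right_field (X j) (eta t) + w j)) ->
  gam 0 = eta 0 -> gam =1 eta.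
Proof.
move=> Xlin Ul dg de ge0 t.
have sq := quotient_solves Xlin Ul dg de.
have q0 : ((gam 0)^-1 * eta 0)%g = 1%g by rewrite ge0 mulVg.
have := linear_system_unique Xlin Ul sq q0 t => H.
by apply: (@mulgI G (gam t)^-1%g); rewrite mulVg H.
Qed.

Lemma loc_lip_time1 (R : realType) : loc_lip (@time1 R).
Proof. by move=> T; exists 1 => // j s t _ _; rewrite mul1r. Qed.

Section Defect.
Variables (R : realType) (n k : nat) (G : lieGroupType R n) (H : lieGroupType R k).
Variables (F : G -> H) (F_hom : lie_hom F) (J : finType).
Variables (X : J -> vector_field G) (Y : J -> vector_field H).
Hypotheses (Xlin : forall j, linear_field (X j)) (Ylin : forall j, linear_field (Y j)).

Local Notation c1 := (chart_at (1%g : G)).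
Local Notation d1 := (chart_at (1%g : H)).

(** The failure of F to relate X_j and Y_j at g, right-trivialized. *)
Definition defect (j : J) (g : G) : 'rV[R]_k :=
  lie_diff F (right_field (X j) g) - right_field (Y j) (F g).

(** The linear part of the defect at the identity. *)
Definition Ldefect (j : J) (v : 'rV[R]_n) : 'rV[R]_k :=
  lie_diff F (Dfield X j v) - Dfield Y j (lie_diff F v).

(** Both terms of the defect are cocycles, for the same action since
dF Ad(a) = Ad(F a) dF. *)
Lemma defect_cocycle j g h : defect j h = Ad (F g)^-1%g (defect j (g * h)%g - defect j g).
Proof.
rewrite /defect (linear_field_cocycle g h (Xlin j)).
rewrite (linear_field_cocycle (F g) (F h) (Ylin j)) -F_hom.2.
rewrite (lie_diff_Ad F_hom) (lie_homV F_hom) -AdB lie_diffB; congr (Ad _ _).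
exact: subrACA.
Qed.

Lemma defect1 j : defect j 1%g = 0.
Proof. by rewrite (defect_cocycle j 1%g) mulg1 subrr /Ad /D_in linear0. Qed.

Lemma defect_bound j g : exists2 B : R, 0 < B &
  forall h, `|defect j (g * h)%g - defect j g| <= B * `|defect j h|.
Proof.
have [_ _ _ df] := conj_diff_in (F g).
have [B B0 HB] := diff_bound df; exists B => // h.
have -> : defect j (g * h)%g - defect j g = Ad (F g) (defect j h).
  have := AdK (F g)^-1%g (defect j (g * h)%g - defect j g).
  by rewrite -defect_cocycle invgK => ->.
exact: HB.
Qed.

Lemma Ldefect_lin j (a : 'I_n -> R) v :
  Ldefect j (\sum_i a i *: v i) = \sum_i a i *: Ldefect j (v i).
Proof.
have lin (V W : lmodType R) (f : {linear V -> W}) (u : 'I_n -> V) :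
    f (\sum_i a i *: u i) = \sum_i a i *: f (u i).
  by rewrite linear_sum; apply: eq_bigr => i _; rewrite linearZ.
have EX u : Dfield X j (\sum_i a i *: u i) = \sum_i a i *: Dfield X j (u i) by exact: lin.
have EY u : Dfield Y j (\sum_i a i *: u i) = \sum_i a i *: Dfield Y j (u i) by exact: lin.
have EF u : lie_diff F (\sum_i a i *: u i) = \sum_i a i *: lie_diff F (u i) by exact: lin.
rewrite /Ldefect EX EF EF EY -sumrB; apply: eq_bigr => i _.
by rewrite scalerBr.
Qed.

Lemma defect_approx j : approx1 (defect j) (Ldefect j).
Proof.
move=> e e0.
have [_ _ cF dF] := lie_diff_in F_hom.
have [K1 K10 HK1] := diff_bound dF.
have [K2 K20 HK2] := Dfield_bound Y.
have K1p : 0 < K1 + 1 by rewrite addr_gt0.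
have e10 : 0 < e / (3 * K1) by rewrite divr_gt0 // mulr_gt0.
have [rho1 rho10 H1] := right_field_approx j Xlin e10.
have e30 : 0 < e / (3 * (K1 + 1)) by rewrite divr_gt0 // mulr_gt0.
have [rho3 rho30 H3] := right_field_approx j Ylin e30.
pose e2 := Num.min 1 (e / (3 * K2)).
have e20 : 0 < e2 by rewrite lt_min ltr01 divr_gt0 // mulr_gt0.
have c11 := chart_atP (1%g : G).
have ndom : \forall x \near chart c1 1%g, chart_dom d1 (F (chart_inv c1 x)).
  have Fc : F (chart_inv c1 x) @[x --> chart c1 1%g] --> F 1%g.
    exact: cvg_comp (chart_inv_cont c11) cF.
  apply: Fc; rewrite (lie_hom1 F_hom); apply: chart_dom_near; exact: chart_atP.
have [rho2 rho20 H2] := near_chart (filterI ndom (diff_approx dF e20)).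
exists (Num.min rho1 (Num.min rho2 (rho3 / (K1 + 1)))).
  by rewrite !lt_min rho10 rho20 divr_gt0.
move=> p cp; rewrite !le_min => /and3P[p1 p2 p3].
have [] := H2 _ p2; rewrite /= !chartK // (lie_hom1 F_hom).
set v := chart c1 p - chart c1 1%g; set w := chart d1 (F p) - chart d1 1%g.
move=> Fd; rewrite -/(lie_diff F v) => Fw.
have dv : dist1 p = `|v| by [].
have dw : dist1 (F p) = `|w| by [].
have e21 : e2 <= 1 by rewrite ge_min lexx.
have e2K : e2 <= e / (3 * K2) by rewrite ge_min lexx orbT.
have Lv u : `|lie_diff F u| <= K1 * `|u| by exact: HK1.
have wle : `|w| <= (K1 + 1) * `|v|.
  rewrite -[w](subrK (lie_diff F v)); apply: (le_trans (ler_normD _ _)).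
  rewrite addrC mulrDl mul1r lerD //; apply: (le_trans Fw).
  by rewrite -[leRHS]mul1r ler_wpM2r.
have p3' : dist1 (F p) <= rho3.
  rewrite dw; apply: (le_trans wle).
  by rewrite mulrC -ler_pdivlMr // -dv.
have X1 := H1 p cp p1; have Y1 := H3 (F p) Fd p3'.
rewrite -/v dv in X1; rewrite -/w dw in Y1; rewrite dv.
have -> : defect j p - Ldefect j v =
   lie_diff F (right_field (X j) p - Dfield X j v) -
   (right_field (Y j) (F p) - Dfield Y j w) - Dfield Y j (w - lie_diff F v).
  rewrite /defect /Ldefect subrACA.
  rewrite -[RHS]addrA -opprD; congr (_ - _); first by rewrite [RHS]lie_diffB.
  have EB : Dfield Y j (w - lie_diff F v) = Dfield Y j w - Dfield Y j (lie_diff F v).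
    exact: linearB.
  by rewrite EB addrA subrK.
apply: (le_trans (ler_normB _ _)).
apply: (le_trans (lerD (ler_normB _ _) (lexx _))).
have A1 : `|lie_diff F (right_field (X j) p - Dfield X j v)| <= e / 3 * `|v|.
  apply: (le_trans (Lv _)); apply: (@le_trans _ _ (K1 * (e / (3 * K1) * `|v|))).
    by rewrite ler_pM2l.
  by rewrite le_eqVlt; apply/orP; left; apply/eqP; field; rewrite gt_eqF.
have A2 : `|right_field (Y j) (F p) - Dfield Y j w| <= e / 3 * `|v|.
  apply: (le_trans Y1); apply: (@le_trans _ _ (e / (3 * (K1 + 1)) * ((K1 + 1) * `|v|))).
    by rewrite ler_pM2l.
  by rewrite le_eqVlt; apply/orP; left; apply/eqP; field; rewrite gt_eqF.
have A3 : `|Dfield Y j (w - lie_diff F v)| <= e / 3 * `|v|.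
  apply: (le_trans (HK2 _ _)); apply: (@le_trans _ _ (K2 * (e / (3 * K2) * `|v|))).
    by rewrite ler_pM2l //; apply: (le_trans Fw); rewrite ler_wpM2r.
  by rewrite le_eqVlt; apply/orP; left; apply/eqP; field; rewrite gt_eqF.
by lra.
Qed.

Lemma defect_eq0 j : connected [set: G] -> (forall v, Ldefect j v = 0) ->
  forall g, defect j g = 0.
Proof.
move=> conn L0; apply: (cocycle_eq0 (defect_bound j) _ conn (defect1 j)).
move=> e e0; have [rho rho0 Hrho] := defect_approx j e0.
by exists rho => // p cp pr; have := Hrho p cp pr; rewrite L0.
Qed.

Lemma combination_approx (c : J -> R) :
  approx1 (fun g => \sum_j c j *: defect j g) (fun v => \sum_j c j *: Ldefect j v).
Proof.
move=> e e0.
pose C := 1 + \sum_j `|c j|.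
have C0 : 0 < C by rewrite ltr_pwDl // sumr_ge0.
have eC : 0 < e / C by rewrite divr_gt0.
pose rho j := projT1 (cid2 (defect_approx j eC)).
have rhoP j : 0 < rho j /\ forall p, chart_dom c1 p -> dist1 p <= rho j ->
    `|defect j p - Ldefect j (chart c1 p - chart c1 1%g)| <= e / C * dist1 p.
  by rewrite /rho; case: cid2.
exists (\big[Num.min/1]_j rho j).
  by apply: lt_bigmin => // j _; exact: (rhoP j).1.
move=> p cp pr; set v := chart c1 p - _.
have -> : \sum_j c j *: defect j p - \sum_j c j *: Ldefect j v =
   \sum_j c j *: (defect j p - Ldefect j v).
  by rewrite -sumrB; apply: eq_bigr => j _; rewrite -scalerBr.
apply: (le_trans (ler_norm_sum _ _ _)).
apply: (@le_trans _ _ (\sum_j `|c j| * (e / C * dist1 p))).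
  apply: ler_sum => j _; rewrite normrZ ler_wpM2l //.
  by apply: (rhoP j).2 => //; apply: (le_trans pr); exact: bigmin_le_cond.
rewrite -mulr_suml.
apply: (@le_trans _ _ (C * (e / C * dist1 p))).
  apply: ler_wpM2r; first exact: mulr_ge0 (ltW eC) (normr_ge0 _).
  by rewrite /C lerDr.
by rewrite le_eqVlt; apply/orP; left; apply/eqP; field; rewrite gt_eqF.
Qed.

End Defect.

Section Main.
Variables (R : realType) (n k m : nat) (G : lieGroupType R n) (H : lieGroupType R k).
Variables (X Z : 'I_m.+1 -> vector_field G) (Y W : 'I_m.+1 -> vector_field H).
Hypotheses (Xlin : forall j, linear_field (X j)) (Ylin : forall j, linear_field (Y j)).
Hypotheses (Zinv : forall j, right_invariant (Z j)) (Winv : forall j, right_invariant (W j)).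
Variables (F : G -> H) (F_hom : lie_hom F).
Variable Adm : set (R -> 'rV[R]_m).
Hypothesis AdmL : forall u, Adm u -> Linfty_loc u.
Variables (phi : R -> G -> (R -> 'rV[R]_m) -> G) (theta : R -> H -> (R -> 'rV[R]_m) -> H).
Hypothesis phi_sol : solution_map (affine_velocity X Z) Adm phi.
Hypothesis theta_sol : solution_map (affine_velocity Y W) Adm theta.

Lemma phi_log_mder u g t : Adm u -> log_mder (ctrl_primitive u) (fun t => phi t g u) t
  (fun j => right_field (X j) (phi t g u) + Z j 1%g).
Proof. by move=> Au; exact: (solution_log_mder (AdmL Au) (phi_sol g Au).2 Zinv). Qed.

Lemma theta_log_mder u h t : Adm u -> log_mder (ctrl_primitive u) (fun t => theta t h u) t
  (fun j => right_field (Y j) (theta t h u) + W j 1%g).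
Proof. by move=> Au; exact: (solution_log_mder (AdmL Au) (theta_sol h Au).2 Winv). Qed.

Lemma F_phi_log_mder u g t : Adm u -> log_mder (ctrl_primitive u) (fun t => F (phi t g u)) t
  (fun j => lie_diff F (right_field (X j) (phi t g u)) + lie_diff F (Z j 1%g)).
Proof.
move=> Au; have lt := loc_lip_at t (ctrl_primitive_loc_lip (AdmL Au)).
have := log_mder_hom F_hom lt (phi_log_mder g t Au).
congr (log_mder _ _ _ _); apply/funext => j.
by rewrite /lie_diff /D_in linearD.
Qed.

Lemma conjugate_of_related :
  (forall j g, lie_diff F (right_field (X j) g) = right_field (Y j) (F g)) ->
  (forall j, lie_diff F (Z j 1%g) = W j 1%g) ->
  forall g t u, Adm u -> F (phi t g u) = theta t (F g) u.
Proof.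
move=> XY ZW g t u Au.
have dF s : log_mder (ctrl_primitive u) (fun t => F (phi t g u)) s
    (fun j => right_field (Y j) (F (phi s g u)) + W j 1%g).
  have := F_phi_log_mder g s Au.
  by congr (log_mder _ _ _ _); apply/funext => j; rewrite XY ZW.
apply: (affine_unique Ylin (ctrl_primitive_loc_lip (AdmL Au)) dF
  (fun t => theta_log_mder (F g) t Au)).
by rewrite (phi_sol g Au).1 (theta_sol (F g) Au).1.
Qed.

(** A field is the velocity of its flow at time 0, and determines the flow by
uniqueness; both statements use the single clock t. *)
Lemma flows_related (varphi : R -> G -> G) (psi : R -> H -> H) j :
  is_flow (X j) varphi -> is_flow (Y j) psi ->
  (forall t, F \o varphi t = psi t \o F) <->
  (forall g, lie_diff F (right_field (X j) g) = right_field (Y j) (F g)).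
Proof.
move=> fX fY.
have dF g t := log_mder_hom F_hom (lip_time1 t) (flow_log_mder g t fX).
have v0 g : varphi 0 g = g by case: (fX g).
have p0 h : psi 0 h = h by case: (fY h).
split=> [FF g|XY t].
  have [_ d1] := dF g 0.
  have := flow_log_mder (F g) 0 fY.
  have -> : psi^~ (F g) = F \o varphi^~ g.
    by apply/funext => t; exact: esym (congr1 (fun f => f g) (FF t)).
  by move=> [_ d2]; have := time1_unique d1 d2; rewrite v0 p0.
apply/funext => g /=.
have := @affine_unique _ _ H 'I_1 (fun=> Y j) (fun=> 0) (@time1 R)
   (fun t => F (varphi t g)) (psi^~ (F g)) (fun=> Ylin j) (@loc_lip_time1 R).
apply.
- move=> s; have := dF g s; congr (log_mder _ _ _ _); apply/funext => i.
  by rewrite addr0 XY.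
- move=> s; have := flow_log_mder (F g) s fY; congr (log_mder _ _ _ _); apply/funext => i.
  by rewrite addr0.
- by rewrite v0 p0.
Qed.

Hypothesis G_conn : connected [set: G].
Hypothesis Adm_nd : nondegenerate_class Adm.
Hypothesis F_conj : forall g t u, Adm u -> F (phi t g u) = theta t (F g) u.

Local Notation mu := (@lebesgue_measure R).
Local Notation d j := (lie_diff F (Z j 1%g) - W j 1%g).

(** Nondegeneracy, applied to each coordinate of the vectors V j. *)
Lemma ctrl_independent (V : 'I_m.+1 -> 'rV[R]_k) :
  (forall u, Adm u -> {ae mu, forall t, \sum_j ctrl u j t *: V j = 0}) ->
  forall j, V j = 0.
Proof.
move=> HV j; apply/rowP => l; rewrite [RHS]mxE.
have [|a0 a] := Adm_nd (a0 := V ord0 ord0 l) (a := \row_i V (lift ord0 i) ord0 l).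
  move=> u Au; have aeF := ae_filter_ringOfSetsType mu.
  apply: filterS (HV u Au) => t; rewrite ctrl_combination => /rowP/(_ l).
  rewrite !mxE summxE => H0; rewrite -[RHS]H0; congr (_ + _).
  by apply: eq_bigr => i _; rewrite !mxE mulrC.
case: (unliftP ord0 j) => [i ->|-> //].
by have /rowP/(_ i) := a; rewrite !mxE.
Qed.

(** At a time where the clocks are differentiable, the two descriptions of the
curve F(phi_t(g, u)) = theta_t(F g, u) have the same velocity. *)
Lemma ae_defect u : Adm u -> {ae mu, forall t, forall g,
  \sum_j ctrl u j t *: (defect F X Y j (phi t g u) + d j) = 0}.
Proof.
move=> Au; have aeF := ae_filter_ringOfSetsType mu.
apply: filterS (ctrl_primitive_ae (AdmL Au)) => t Ht g.
have [_ d1] := F_phi_log_mder g t Au.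
have D2 := theta_log_mder (F g) t Au.
have E : (fun t => theta t (F g) u) = fun t => F (phi t g u).
  by apply/funext => s; rewrite F_conj.
rewrite E -F_conj // in D2; case: D2 => _ d2.
have := has_mder_unique Ht d1 d2 => /eqP; rewrite -subr_eq0 -sumrB => /eqP Hs.
rewrite -[RHS]Hs; apply: eq_bigr => j _.
by rewrite -scalerBr /defect; congr (_ *: _); rewrite addrACA -opprD.
Qed.

(** The trajectories with initial points g and e have a quotient that solves the
linear system, and the vanishing of the defects along both of them passes to
the quotient by the cocycle identity. *)
Lemma ae_defect_span u : Adm u -> {ae mu, forall t, forall w,
  \sum_j ctrl u j t *: Ldefect F X Y j w = 0}.
Proof.
move=> Au; have aeF := ae_filter_ringOfSetsType mu.
apply: filterS (ae_defect Au) => t Ht w.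
have Ul := ctrl_primitive_loc_lip (AdmL Au).
pose S g s := ((phi s 1%g u)^-1 * phi s g u)%g.
have SU g : solves X (ctrl_primitive u) (S g).
  exact: (quotient_solves Xlin Ul (fun t => phi_log_mder 1%g t Au) (fun t => phi_log_mder g t Au)).
have S0 g : S g 0 = g by rewrite /S !(phi_sol _ Au).1 invg1 mul1g.
have ES g : \sum_j ctrl u j t *: defect F X Y j (S g t) = 0.
  have E j : defect F X Y j (S g t) = Ad (F (phi t 1%g u))^-1%g
      (defect F X Y j (phi t g u) - defect F X Y j (phi t 1%g u)).
    by rewrite (defect_cocycle F_hom Xlin Ylin j (phi t 1%g u) (S g t)) /S mulVKg.
  under eq_bigr do rewrite E -AdZ.
  rewrite -Ad_sum.
  have -> : \sum_j ctrl u j t *: (defect F X Y j (phi t g u) -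
      defect F X Y j (phi t 1%g u)) = 0.
    have := congr2 (fun a b => a - b) (Ht g) (Ht 1%g).
    rewrite subrr -sumrB => D0; rewrite -[RHS]D0; apply: eq_bigr => j _; rewrite -scalerBr.
    congr (_ *: _).
    have addBB (a b c : 'rV[R]_k) : a - b = (a + c) - (b + c).
      by rewrite opprD addrACA subrr addr0.
    exact: addBB.
  by rewrite /Ad /D_in linear0.
have [sg sg1 tE] := sign_split t.
have [K K0 UK] := Ul (`|t| + `|t| + 1 + (`|t| + `|t| + 1)).
have UK1 : lip_on (reparam (ctrl_primitive u) 0 sg) (`|t| + `|t| + 1) K.
  move=> j p q pT qT; apply: (reparam_lip_on sg1 _ _ (T := `|t| + `|t|)) => //.
    by rewrite normr0 addr_ge0.
  move=> i p' q' p'T q'T; apply: UK; [apply: (le_trans p'T)|apply: (le_trans q'T)]; lra.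
apply: (@linearized_span _ _ G _ X Xlin _ (reparam (ctrl_primitive u) 0 sg) `|t| K
  (fun g s => S g (0 + sg * s)) (fun v => \sum_j ctrl u j t *: Ldefect F X Y j v)
  (fun g => \sum_j ctrl u j t *: defect F X Y j g)) => //.
- by move=> g; rewrite mulr0 addr0 S0.
- by move=> g; exact: solves_reparam.
- move=> a v; under eq_bigr do rewrite Ldefect_lin scaler_sumr.
  rewrite exchange_big; apply: eq_bigr => i _; rewrite scaler_sumr.
  by apply: eq_bigr => j _; rewrite !scalerA mulrC.
- exact: (combination_approx F_hom Xlin Ylin).
- by move=> g; rewrite add0r -tE ES.
Qed.

Lemma related_of_conjugate :
  (forall j g, lie_diff F (right_field (X j) g) = right_field (Y j) (F g)) /\
  (forall j, lie_diff F (Z j 1%g) = W j 1%g).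
Proof.
have aeF := ae_filter_ringOfSetsType mu.
have L0 j v : Ldefect F X Y j v = 0.
  move: j; apply: ctrl_independent => u Au.
  by apply: filterS (ae_defect_span Au) => t; apply.
have E0 j g : defect F X Y j g = 0.
  by apply: (defect_eq0 F_hom Xlin Ylin G_conn) => v; exact: L0.
split=> [j g|j]; apply/eqP; rewrite -subr_eq0; apply/eqP; first exact: E0.
move: j; apply: ctrl_independent => u Au.
apply: filterS (ae_defect Au) => t /(_ 1%g) Ht; rewrite -[RHS]Ht.
by apply: eq_bigr => j _; rewrite E0 add0r.
Qed.

End Main.

Theorem theorem4p2 (R : realType) (n k m : nat)
    (G : lieGroupType R n) (H : lieGroupType R k)
    (G_connected : connected [set: G]) (H_connected : connected [set: H])
    (X : 'I_m.+1 -> vector_field G) (Y : 'I_m.+1 -> vector_field H)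
    (X_linear : forall i, linear_field (X i))
    (Y_linear : forall i, linear_field (Y i))
    (X_commute : pairwise_commuting X) (Y_commute : pairwise_commuting Y)
    (varphi : 'I_m.+1 -> R -> G -> G) (psi : 'I_m.+1 -> R -> H -> H)
    (varphi_flow : forall i, is_flow (X i) (varphi i))
    (psi_flow : forall i, is_flow (Y i) (psi i))
    (Z : 'I_m.+1 -> vector_field G) (W : 'I_m.+1 -> vector_field H)
    (Z_right_invariant : forall j, right_invariant (Z j))
    (W_right_invariant : forall j, right_invariant (W j))
    (U : set 'rV[R]_m) (Adm : set (R -> 'rV[R]_m))
    (Adm_admissible : admissible_class U Adm)
    (Adm_nondegenerate : nondegenerate_class Adm)
    (phi : R -> G -> (R -> 'rV[R]_m) -> G)
    (theta : R -> H -> (R -> 'rV[R]_m) -> H)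
    (phi_solution : solution_map (affine_velocity X Z) Adm phi)
    (theta_solution : solution_map (affine_velocity Y W) Adm theta)
    (F : G -> H) (F_hom : lie_hom F) :
  (forall (g : G) (t : R) (u : R -> 'rV[R]_m), Adm u ->
     F (phi t g u) = theta t (F g) u)
  <->
  (forall i j : 'I_m.+1,
     (forall t : R, F \o varphi i t = psi i t \o F) /\
     tangent_map F 1%g (Z j 1%g) = W j 1%g).
Proof.
have AdmL u : Adm u -> Linfty_loc u by move=> /Adm_admissible[].
split=> [FF i j|rel].
  have [XY ZW] := related_of_conjugate X_linear Y_linear Z_right_invariant
    W_right_invariant F_hom AdmL phi_solution theta_solution G_connected
    Adm_nondegenerate (fun g t u => FF g t u).
  split; last by rewrite lie_diffE.
  exact: (flows_related Y_linear F_hom (varphi_flow i) (psi_flow i)).2 (XY i).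
move=> g t u; apply: (conjugate_of_related Y_linear Z_right_invariant
  W_right_invariant F_hom AdmL phi_solution theta_solution) => [j|j].
  exact: (flows_related Y_linear F_hom (varphi_flow j) (psi_flow j)).1 (rel j j).1.
by rewrite -lie_diffE //; exact: (rel j j).2.
Qed.
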